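(* Let $\varepsilon\in(0,\tfrac14]$, $p\ge1$, $s\in(0,1)$ with $sp\ge1$, and $T\in\mathbb{N}$. Then the equispaced configuration $\mathbf{X}^{\mathrm{eq}}=\mathbb{Z}$ is, up to translations, the unique minimiser of $\mathcal{F}^{s,\varepsilon}_p$ in $\mathbb{X}^{4\varepsilon}_T$.
   Context: One-dimensional setting. Let $T\in\mathbb{N}$. A configuration is a set $\mathbf{X}=\bigcup_{k\in\mathbb{Z}}(\bar{\mathbf{X}}+kT)$ with $\bar{\mathbf{X}}=(x_1,\dots,x_T)\in[0,T)^T$, $x_i\le x_j$ for $i<j$. $\mathrm{d}[\mathbf{X}]$ is the minimal distance $|x_i-x_j|$ between points with distinct indices; for $l\in(0,1]$, $\mathbb{X}^l_T=\{\mathbf{X}:\mathrm{d}[\mathbf{X}]\ge l\}$. Translations: $\mathbf{X}+a=\{x+a:x\in\mathbf{X}\}$. $u[\mathbf{X}]$ is the $T$-periodic function (defined up to an additive constant) with distributional derivative $\mathcal{L}^1-\sum_{x\in\mathbf{X}}\delta_x$. Let $\rho$ be a standard (smooth, nonnegative, even, unit-mass) mollifier supported in $(-1,1)$, $\rho_\varepsilon(x)=\varepsilon^{-1}\rho(x/\varepsilon)$, $u^\varepsilon[\mathbf{X}]=u[\mathbf{X}]*\rho_\varepsilon$, and $\mathcal{F}^{s,\varepsilon}_p[\mathbf{X}]=\int_0^T\int_{\mathbb{R}}\frac{|u^\varepsilon[\mathbf{X}](x)-u^\varepsilon[\mathbf{X}](y)|^p}{|x-y|^{1+sp}}\,\mathrm{d}y\,\mathrm{d}x$.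 *)

(* Defs.v *)
From HB Require Import structures.
From mathcomp Require Import all_boot all_order all_algebra.
From mathcomp Require Import all_classical all_reals all_analysis.
Set Implicit Arguments. Unset Strict Implicit. Unset Printing Implicit Defensive.
Import Order.TTheory GRing.Theory Num.Theory.
Import numFieldNormedType.Exports.
Local Open Scope classical_set_scope.
Local Open Scope ring_scope.

Section Defs.
Variable R : realType.

Definition is_config (T : nat) (xb : 'I_T -> R) : Prop :=
  (forall i, 0 <= xb i < T%:R) /\ (forall i j : 'I_T, (i <= j)%N -> xb i <= xb j).

Definition cfg_set (T : nat) (xb : 'I_T -> R) : set R :=
  [set x | exists (i : 'I_T) (k : int), x = xb i + k%:~R * T%:R].

Definition dmin (T : nat) (xb : 'I_T -> R) : R :=
  inf [set d | exists (i j : 'I_T) (k m : int), (i, k) <> (j, m) /\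
         d = `| (xb i + k%:~R * T%:R) - (xb j + m%:~R * T%:R) | ].

Definition Xclass (l : R) (T : nat) (xb : 'I_T -> R) : Prop :=
  is_config xb /\ l <= dmin xb.

Definition Xeq (T : nat) : 'I_T -> R := fun i => (i : nat)%:R.

(* A representative of u[X]: x - sum_i floor((x - x_i)/T).  It is T-periodic
   with distributional derivative L^1 - sum_{x in X} delta_x; u[X] is only
   defined up to an additive constant, which does not affect F. *)
Definition uX (T : nat) (xb : 'I_T -> R) (x : R) : R :=
  x - \sum_(i < T) (Num.floor ((x - xb i) / T%:R))%:~R.

Definition smooth (f : R -> R) : Prop :=
  forall (n : nat) (x : R), derivable (derive1n n f) x 1.

Definition std_mollifier (rho : R -> R) : Prop :=
  [/\ smooth rho,
      (forall x, 0 <= rho x),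
      (forall x, rho (- x) = rho x),
      (\int[@lebesgue_measure R]_x (rho x)%:E = 1)%E &
      closure [set x | rho x != 0] `<=` `]-1, 1[ ].

Definition rho_eps (rho : R -> R) (eps : R) (x : R) : R := eps^-1 * rho (x / eps).

Definition ueps (rho : R -> R) (eps : R) (T : nat) (xb : 'I_T -> R) (x : R) : R :=
  Rintegral (@lebesgue_measure R) setT (fun y => uX xb (x - y) * rho_eps rho eps y).

Local Open Scope ereal_scope.
Definition Fsep (rho : R -> R) (s p eps : R) (T : nat) (xb : 'I_T -> R) : \bar R :=
  \int[@lebesgue_measure R]_(x in `[0%R, T%:R[%classic)
    \int[@lebesgue_measure R]_y
      (((`| ueps rho eps xb x - ueps rho eps xb y | `^ p) /
        (`| x - y | `^ (1 + s * p)))%R)%:E.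

End Defs.

(* Main.v *)
Require Import Defs.
From HB Require Import structures.
From mathcomp Require Import all_boot all_order all_algebra.
From mathcomp Require Import all_classical all_reals all_analysis.
From mathcomp Require Import measurable_realfun.
From mathcomp Require Import ring lra zify.
Set Implicit Arguments. Unset Strict Implicit. Unset Printing Implicit Defensive.
Import Order.TTheory GRing.Theory Num.Theory.
Import numFieldNormedType.Exports.
Local Open Scope classical_set_scope.
Local Open Scope ring_scope.

(** The energy is an integral over shifts [h], with weight [|h|^(-1-sp)], of
    [int_0^T |u(x+h) - u(x)|^p dx], and the lattice minimises the inner integral
    for every [h].  Let [S] be the mollification of [floor (./T)] and [k] the
    integer nearest to [h].  Pairing the up-jump of [x_i] at shift [h] with the
    down-jump of [x_(i-k)],
      [u(x+h) - u(x) = (h - k) - sum_i (S (x + h - x_i) - S (x - x_(i-k)))].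
    Points at distance at least [2 eps] make all paired jumps at a given [x]
    have the same sign, so convexity bounds the energy below by that of the
    separate jumps, which depends only on the displacements
    [d_i = h - (x_i - x_(i-k))], whose mean is [h - k].  As a function of [d] the
    energy of one jump satisfies Wright's form of convexity: this is a
    pointwise inequality after translating two of the four integrands.  Jensen
    then gives equal displacements as the optimum, and the lattice attains the
    bound because there at most one paired jump is nonzero at each [x].  Since
    [sp >= 1 > s] forces [p > 1], the inequality is strict for [h] near [1]
    unless all gaps are [1]; as the lattice energy is finite, this gives
    uniqueness. *)

(** * Wright convexity *)

Section WrightConvexity.
Context {R : realType}.
Implicit Types (f : R -> R) (x y p : R).

(** All coefficients are 1, in contrast with convex combinations, so the inequality passes to
    integrals whose integrands may be translated separately. *)
Definition wright_convex f :=
  forall x a b, 0 <= a -> 0 <= b -> f (x + a) + f (x + b) <= f x + f (x + a + b).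

Definition strictly_wright_convex f :=
  forall x a b, 0 < a -> 0 < b -> f (x + a) + f (x + b) < f x + f (x + a + b).

Lemma strictly_wright_convexW f : strictly_wright_convex f -> wright_convex f.
Proof.
move=> fc x a b; rewrite le_eqVlt => /predU1P[<-|a0].
  by rewrite addr0 lexx.
rewrite le_eqVlt => /predU1P[<-|b0]; first by rewrite !addr0 addrC.
exact/ltW/fc.
Qed.

(** Young's inequality with exponents [p] and [p / (p - 1)], applied to the product of [x] and 1. *)
Lemma bernoulli_powR x p : 1 < p -> 0 <= x -> 1 + p * (x - 1) <= x `^ p.
Proof.
move=> p1 x0; have p0 : 0 < p by lra.
have q0 : 0 < p / (p - 1) by rewrite divr_gt0//; lra.
have pq : p^-1 + (p / (p - 1))^-1 = 1.
  by rewrite invf_div; field; lra.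
have := @conjugate_powR _ x 1 p (p / (p - 1)) x0 ler01 p0 q0 pq.
rewrite mulr1 powR1 div1r invf_div -mulrDl ler_pdivlMr//; lra.
Qed.

(* Applying the weak inequality to [sqrt x] and squaring gains [(p^2 - p) (sqrt x - 1)^2]. *)
Lemma bernoulli_powR_lt x p : 1 < p -> 0 <= x -> x != 1 ->
  1 + p * (x - 1) < x `^ p.
Proof.
move=> p1 x0 x1; set y := Num.sqrt x.
have y0 : 0 <= y by exact: sqrtr_ge0.
have xy : x = y * y by rewrite -expr2 sqr_sqrtr.
have y1 : 0 < (y - 1) ^+ 2.
  rewrite exprn_even_gt0//= subr_eq0; apply: contra x1 => /eqP y1.
  by rewrite xy y1 mulr1.
have -> : x `^ p = y `^ p * y `^ p by rewrite xy powRM.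
have := bernoulli_powR p1 y0; set b := 1 + p * (y - 1) => hb.
have [b0|b0] := leP 0 b.
  apply: (@lt_le_trans _ _ (b * b)); last exact: ler_pM.
  rewrite -subr_gt0 xy (_ : _ - _ = (p * (p - 1)) * (y - 1) ^+ 2); last by rewrite /b; ring.
  by rewrite mulr_gt0// mulr_gt0//; lra.
apply: (@lt_le_trans _ _ 0); last by rewrite mulr_ge0// powR_ge0.
rewrite /b in b0.
have : y < 1.
  have : p * (y - 1) < p * 0 by lra.
  rewrite ltr_pM2l; lra.
move=> yl1.
have : y * y <= y * 1 by rewrite ler_wpM2l// ltW.
rewrite -xy mulr1 => xley.
have : p * (x - 1) <= p * (y - 1) by rewrite ler_pM2l; lra.
lra.
Qed.

(** A strict supporting line. For [x != 0], division by [|x|^p] reduces it to the strict Bernoulli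
    inequality at [r = y / x]; for [r < 0] the line is already negative. *)
Lemma normr_powR_tangent p x : 1 < p ->
  exists c, forall y, y != x -> `|x| `^ p + c * (y - x) < `|y| `^ p.
Proof.
move=> p1; have [->|x0] := eqVneq x 0.
  exists 0 => y y0; rewrite mul0r addr0 normr0 powR0; last by lra.
  by rewrite powR_gt0// normr_gt0.
exists (p * `|x| `^ p / x) => y yx; set r := y / x.
have yE : y = x * r by rewrite /r mulrC divfK.
have r1 : r != 1 by apply: contra yx => /eqP r1; rewrite yE r1 mulr1.
have px : 0 < `|x| `^ p by rewrite powR_gt0// normr_gt0.
have -> : `|y| `^ p = `|x| `^ p * `|r| `^ p by rewrite yE normrM powRM.
have -> : `|x| `^ p + p * `|x| `^ p / x * (y - x) = `|x| `^ p * (1 + p * (r - 1)).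
  by rewrite yE; field.
rewrite ltr_pM2l//; have [r0|r0] := leP 0 r.
  by rewrite ger0_norm//; exact: bernoulli_powR_lt.
apply: (@lt_le_trans _ _ 0); last exact: powR_ge0.
have : p * (r - 1) < p * (- 1) by rewrite ltr_pM2l; lra.
lra.
Qed.

(** The supporting lines at the inner points [x + a] and [x + b] each bound both outer values from
    below. The two bounds from one line are combined with weights [a] and [b] so that its slope
    cancels. *)
Lemma strictly_wright_convex_normr_powR p : 1 < p ->
  strictly_wright_convex (fun x => `|x| `^ p).
Proof.
move=> p1 x a b a0 b0.
have [c hc] := normr_powR_tangent (x + a) p1.
have [d hd] := normr_powR_tangent (x + b) p1.
have ne u v : u != v -> v != u by rewrite eq_sym.
have := hc x; have := hc (x + a + b); have := hd x; have := hd (x + a + b).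
set A := `|x + a| `^ p; set B := `|x + b| `^ p.
set X := `|x| `^ p; set Y := `|x + a + b| `^ p.
move=> /(_ _)h1 /(_ _)h2 /(_ _)h3 /(_ _)h4.
have {}h1 : B + d * a < Y.
  by have := h1 _; rewrite (_ : x + a + b - (x + b) = a); [apply; apply/eqP; lra|ring].
have {}h2 : B - d * b < X.
  by have := h2 _; rewrite (_ : d * (x - (x + b)) = - (d * b)); [apply; apply/eqP; lra|ring].
have {}h3 : A + c * b < Y.
  by have := h3 _; rewrite (_ : x + a + b - (x + a) = b); [apply; apply/eqP; lra|ring].
have {}h4 : A - c * a < X.
  by have := h4 _; rewrite (_ : c * (x - (x + a)) = - (c * a)); [apply; apply/eqP; lra|ring].
rewrite -(ltr_pM2l (addr_gt0 a0 b0)).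
have := ltr_pM2l b0 (A - c * a) X; rewrite h4 => k4.
have := ltr_pM2l a0 (A + c * b) Y; rewrite h3 => k3.
have := ltr_pM2l a0 (B - d * b) X; rewrite h2 => k2.
have := ltr_pM2l b0 (B + d * a) Y; rewrite h1 => k1.
nra.
Qed.

(** Induction on the summands: a term [b] and the remaining sum [c] have the same sign, so the pair
    [th - b], [th - c] may be replaced by the wider pair [th], [th - (b + c)] of equal sum. *)
Lemma wright_convex_same_sign_sum f (I : finType) (th : R) (B : I -> R) :
  wright_convex f -> (forall i, 0 <= B i) \/ (forall i, B i <= 0) ->
  f th + \sum_i f (th - B i) <= f (th - \sum_i B i) + #|I|%:R * f th.
Proof.
move=> fc sB.
suff H (s : seq I) : f th + \sum_(i <- s) f (th - B i) <=
    f (th - \sum_(i <- s) B i) + (size s)%:R * f th.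
  by rewrite -big_enum -[in leRHS]big_enum cardE; exact: H.
elim: s => [|i s IHs]; first by rewrite !big_nil addr0 subr0 mul0r addr0.
rewrite !big_cons /=; set b := B i; set c := \sum_(j <- s) B j.
suff : f (th - b) + f (th - c) <= f th + f (th - (b + c)).
  by rewrite -natr1 mulrDl mul1r -/c in IHs *; lra.
have [[b0 c0]|[b0 c0]] : (0 <= b /\ 0 <= c) \/ (b <= 0 /\ c <= 0).
- case: sB => sB; [left|right]; split; rewrite ?sB//; [exact: sumr_ge0|exact: sumr_le0].
- have := fc (th - (b + c)) c b c0 b0.
  have -> : th - (b + c) + c = th - b by ring.
  have -> : th - (b + c) + b = th - c by ring.
  have -> : th - b + b = th by ring.
  lra.
- have := fc th (- b) (- c).
  have -> : th - b - c = th - (b + c) by ring.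
  by apply; rewrite oppr_ge0.
Qed.

(* A pair straddling [c] is replaced by [c] and the complementary point, which
   keeps the sum and increases the number of entries equal to [c]. *)
Lemma wright_convex_jensen_seq f c (s : seq R) : wright_convex f ->
  \sum_(x <- s) (x - c) = 0 -> (size s)%:R * f c <= \sum_(x <- s) f x.
Proof.
move=> fc; move: {2}(size s) (leqnn (size s)) => n.
elim: n s => [|n IHn] s.
  by rewrite leqn0 => /nilP -> _; rewrite big_nil mul0r.
case: s => [|x s]; first by move=> *; rewrite big_nil mul0r.
rewrite /= ltnS big_cons => sn sum0.
have [xc|xc] := eqVneq x c.
  rewrite big_cons xc -natr1 mulrDl mul1r addrC lerD2l.
  by apply: IHn => //; rewrite -[RHS]sum0 xc subrr add0r.
have [y ys opp] : exists2 y, y \in s & (x - c) * (y - c) < 0.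
  apply/hasP; apply/negPn/negP => /hasPn hs.
  have {}hs y : y \in s -> 0 <= (x - c) * (y - c) by move=> /hs; rewrite -leNgt.
  have : 0 <= \sum_(y <- s) (x - c) * (y - c) by rewrite big_seq sumr_ge0.
  rewrite -mulr_sumr; have -> : \sum_(y <- s) (y - c) = - (x - c) by lra.
  rewrite mulrN oppr_ge0 leNgt -expr2 => /negP; apply.
  by rewrite exprn_even_gt0//= subr_eq0.
have ps := perm_to_rem ys.
rewrite big_cons (perm_big _ ps)/= big_cons.
have := IHn (x + y - c :: rem y s).
rewrite /= !big_cons size_rem// prednK; last by case: (s) ys.
rewrite (perm_big _ ps)/= big_cons in sum0.
move=> /(_ sn); rewrite (_ : _ + _ = 0); last by rewrite -[RHS]sum0; ring.
move=> /(_ erefl) le1; rewrite -natr1 mulrDl mul1r.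
suff : f c + f (x + y - c) <= f x + f y by lra.
have [xlt|xgt] := ltP x c.
  have ylt : c < y by have := opp; rewrite nmulr_rlt0 ?subr_lt0// subr_gt0.
  have := fc x (c - x) (y - c).
  rewrite subrKC (_ : x + (y - c) = x + y - c); last by ring.
  rewrite (_ : c + (y - c) = y); last by ring.
  by apply; rewrite subr_ge0 ltW.
have {}xgt : c < x by rewrite lt_neqAle eq_sym xc.
have ylt : y < c by have := opp; rewrite pmulr_rlt0 ?subr_gt0// subr_lt0.
have := fc y (c - y) (x - c).
rewrite subrKC (_ : y + (x - c) = x + y - c); last by ring.
rewrite (_ : c + (x - c) = x); last by ring.
by rewrite [f y + _]addrC; apply; rewrite subr_ge0 ltW.
Qed.

Lemma wright_convex_jensen f c n (d : 'I_n -> R) : wright_convex f ->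
  \sum_i d i = n%:R * c -> n%:R * f c <= \sum_i f (d i).
Proof.
move=> fc sd; have := @wright_convex_jensen_seq f c [seq d i | i <- index_enum 'I_n] fc.
rewrite !big_map size_map [X in size X]unlock -enumT size_enum_ord; apply.
by rewrite sumrB sd sumr_const card_ord mulr_natl subrr.
Qed.

(** A nonconstant family of mean [c] has entries on both sides of [c]. Replacing one such pair by
    [c] and [d i + d j - c] strictly lowers the sum; the new family [e] still has mean [c] and falls
    under the weak inequality. *)
Lemma wright_convex_jensen_lt f c n (d : 'I_n -> R) : wright_convex f ->
  (forall i j, c < d i -> d j < c -> f c + f (d i + d j - c) < f (d i) + f (d j)) ->
  \sum_i d i = n%:R * c -> (exists i, d i != c) -> n%:R * f c < \sum_i f (d i).
Proof.
move=> fc fs sd [i0 di0].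
have s0 : \sum_i (d i - c) = 0 by rewrite sumrB sd sumr_const card_ord mulr_natl subrr.
(* Used with [s = 1] and [s = -1]: a deviation of one sign forces one of the other sign. *)
have ex (s : R) : s * (d i0 - c) > 0 -> exists j, s * (d j - c) < 0.
  move=> si0; apply/not_existsP => H.
  have : 0 < \sum_i s * (d i - c).
    rewrite (bigD1 i0)//= ltr_pwDl// sumr_ge0// => j _.
    by rewrite leNgt; apply/negP/H.
  by rewrite -mulr_sumr s0 mulr0 ltxx.
have [i [j [dic djc]]] : exists i j, c < d i /\ d j < c.
  have [lt|gt|/eqP] := ltgtP (d i0) c; last by rewrite (negbTE di0).
    have [|j] := ex (-1); first by rewrite mulN1r oppr_gt0 subr_lt0.
    by rewrite mulN1r oppr_lt0 subr_gt0 => ?; exists j, i0.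
  have [|j] := ex 1; first by rewrite mul1r subr_gt0.
  by rewrite mul1r subr_lt0 => ?; exists i0, j.
have ij : i != j by apply: contraTneq dic => ->; rewrite -leNgt ltW.
pose e k := if k == i then c else if k == j then d i + d j - c else d k.
have split2 (F : 'I_n -> R) : \sum_k F k = F i + (F j + \sum_(k | (k != i) && (k != j)) F k).
  by rewrite (bigD1 i)//= (bigD1 j)//= eq_sym.
have eE k : (k != i) && (k != j) -> e k = d k.
  by move=> /andP[/negbTE ki /negbTE kj]; rewrite /e ki kj.
have ei : e i = c by rewrite /e eqxx.
have ej : e j = d i + d j - c by rewrite /e eqxx eq_sym (negbTE ij).
apply: (@le_lt_trans _ _ (\sum_k f (e k))).
  apply: wright_convex_jensen => //; rewrite -sd !split2 ei ej (eq_bigr _ eE); ring.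
rewrite !split2 ei ej.
have -> : \sum_(k | (k != i) && (k != j)) f (e k) = \sum_(k | (k != i) && (k != j)) f (d k).
  by apply: eq_bigr => k /eE ->.
rewrite !addrA ltrD2r; exact: fs.
Qed.

End WrightConvexity.

(** * Periodic integrals *)

Section LebesgueTranslation.
Context {R : realType}.
Notation mu := (@lebesgue_measure R).

Lemma lebesgue_measure_shift (a : R) (A : set R) : measurable A ->
  pushforward mu ((fun x => x + a) : _ -> measurableTypeR R) A = mu A.
Proof.
move=> mA; apply/esym; apply: lebesgue_measure_unique => //=.
  exact: measurable_funD.
move=> ma _ [[b c] _ <-].
rewrite /pushforward (_ : _ @^-1` _ = `]b - a, c - a]%classic).
  by rewrite !lebesgue_measure_itv/= !lte_fin ltrD2r -!EFinB opprB addrA subrK.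
by apply/seteqP; split => x /=; rewrite !in_itv/= ltrBlDr lerBrDr.
Qed.

Lemma ge0_integral_shift (a : R) (D : set R) (f : R -> \bar R) : measurable D ->
  measurable_fun D f -> (forall x, D x -> 0 <= f x)%E ->
  (\int[mu]_(x in (fun x => x + a)%R @^-1` D) f (x + a)%R = \int[mu]_(x in D) f x)%E.
Proof.
move=> mD mf f0.
pose phi : R -> measurableTypeR R := fun x => x + a.
have mphi : measurable_fun setT phi by exact: measurable_funD.
transitivity (\int[pushforward mu phi]_(x in D) f x)%E.
  rewrite ge0_integral_pushforward//.
  by move=> x /set_mem; exact: f0.
by apply: eq_measure_integral => //= A mA AS; exact: lebesgue_measure_shift.
Qed.

(** Periodicity reduces to [0 <= a < T]. The window [[a, T + a[] is then cut at [T], and its second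
    piece is the translate by [T] of [[0, a[]. *)
Lemma ge0_integral_period_shift (T a : R) (f : R -> \bar R) : 0 < T ->
  measurable_fun setT f -> (forall x, 0 <= f x)%E -> (forall x, f (x + T) = f x) ->
  (\int[mu]_(x in `[0%R, T[) f (x + a)%R = \int[mu]_(x in `[0%R, T[) f x)%E.
Proof.
move=> T0 mf f0 fT.
have fTn (n : nat) x : f (x + n%:R * T) = f x.
  elim: n => [|n IHn]; first by rewrite mul0r addr0.
  by rewrite -natr1 mulrDl mul1r addrA fT IHn.
have fTz (n : int) x : f (x + n%:~R * T) = f x.
  case: n => n; first exact: fTn.
  by rewrite NegzE mulrNz mulNr -[LHS](fTn n.+1) subrK.
wlog : a / 0 <= a < T.
  move=> H; pose n := Num.floor (a / T).
  have := H (a - n%:~R * T).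
  have -> : 0 <= a - n%:~R * T < T.
    have := @Num.Theory.floor_itv R (a / T); rewrite -/n => /andP[].
    rewrite ler_pdivlMr// ltr_pdivrMr// intrD mulrDl mul1r => *; lra.
  move=> /(_ isT) <-; apply: eq_integral => x _.
  by rewrite -[RHS](fTz n); congr (f _); ring.
move=> /andP[a0 aT].
have -> : (\int[mu]_(x in `[0%R, T[) f (x + a)%R = \int[mu]_(x in `[a, (T + a)%R[) f x)%E.
  rewrite -(@ge0_integral_shift a `[a, T + a[%classic f)//; last exact: measurable_funTS.
  congr (integral _ _ _); apply/seteqP; split => x /=; rewrite !in_itv/=; lra.
have split (b c d : R) : b <= c <= d ->
  (\int[mu]_(x in `[b, d[) f x = \int[mu]_(x in `[b, c[) f x + \int[mu]_(x in `[c, d[) f x)%E.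
  move=> bcd; rewrite -ge0_integral_setU//=; last 2 first.
  - exact: measurable_funTS.
  - rewrite disj_set2E; apply/eqP; rewrite -subset0 => x []/=; rewrite !in_itv/=; lra.
  congr (integral _ _ _); apply/seteqP; split => x /=; rewrite !in_itv/=; last by case; lra.
  by have [xc|xc] := ltP x c => h; [left|right]; lra.
rewrite (split a T (T + a)); last by lra.
rewrite (split 0 a T); last by lra.
rewrite addeC; congr (_ + _)%E.
rewrite -(@ge0_integral_shift T `[T, T + a[%classic f)//; last exact: measurable_funTS.
under eq_integral do rewrite fT.
congr (integral _ _ _); apply/seteqP; split => x /=; rewrite !in_itv/=; lra.
Qed.

(** A zero integral would make [f] vanish almost everywhere on [D], hence put [A] inside a null
    set. *)
Lemma integral_gt0 (D A : set R) (f : R -> \bar R) : measurable D -> measurable A ->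
  A `<=` D -> (0 < mu A)%E ->
  measurable_fun D f -> (forall x, D x -> 0 <= f x)%E -> (forall x, A x -> 0 < f x)%E ->
  (0 < \int[mu]_(x in D) f x)%E.
Proof.
move=> mD mA AD muA mf f0 fA; rewrite lt0e integral_ge0// andbT.
apply/eqP => int0.
have : (\int[mu]_(x in D) `|f x| = 0)%E.
  by rewrite -[RHS]int0; apply: eq_integral => x /set_mem Dx; rewrite gee0_abs// f0.
move=> /(ae_eq_integral_abs mu mD mf)[N [mN muN DN]].
have : (mu A <= mu N)%E.
  apply: le_measure; rewrite ?inE// => x Ax; apply: DN => /= /(_ (AD _ Ax)) fx.
  by have := fA x Ax; rewrite fx ltxx.
by rewrite muN leNgt muA.
Qed.

End LebesgueTranslation.

(** * Bounded periodic functions and their integral over one period *)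

Section PeriodIntegral.
Context {R : realType} (T : R).
Context (T0 : 0 < T).
Notation mu := (@lebesgue_measure R).
Implicit Types f g : R -> R.

Definition bounded_periodic f :=
  [/\ measurable_fun setT f, (exists M, forall x, `|f x| <= M) &
      forall x, f (x + T) = f x].

Definition period_integral f : R := \int[mu]_(x in `[0, T[) f x.

Lemma bounded_periodic_integrable f : bounded_periodic f ->
  mu.-integrable `[0, T[ (EFin \o f).
Proof.
move=> [mf [M fM] _]; apply: measurable_bounded_integrable => //.
- by rewrite /= lebesgue_measure_itv/=; case: ifP => //; rewrite -EFinB ltry.
- exact: measurable_funTS.
- by exists M; split; [exact: num_real|move=> N MN x _; exact: (le_trans (fM x) (ltW MN))].
Qed.

Lemma bounded_periodicD f g : bounded_periodic f -> bounded_periodic g ->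
  bounded_periodic (fun x => f x + g x).
Proof.
move=> [mf [M fM] fT] [mg [N gN] gT]; split.
- exact: measurable_funD.
- by exists (M + N) => x; rewrite (le_trans (ler_normD _ _))// lerD.
- by move=> x; rewrite fT gT.
Qed.

Lemma bounded_periodicN f : bounded_periodic f -> bounded_periodic (fun x => - f x).
Proof.
move=> [mf [M fM] fT]; split; [|by exists M => x; rewrite normrN|by move=> x; rewrite fT].
exact: measurable_funN.
Qed.

Lemma bounded_periodic_cst c : bounded_periodic (cst c).
Proof. by split=> //; exists `|c|. Qed.

Lemma bounded_periodic_sum (I : Type) (s : seq I) (f : I -> R -> R) :
  (forall i, bounded_periodic (f i)) -> bounded_periodic (fun x => \sum_(i <- s) f i x).
Proof.
move=> bf; elim: s => [|i s IHs].
  under eq_fun do rewrite big_nil; exact: bounded_periodic_cst.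
under eq_fun do rewrite big_cons; exact: bounded_periodicD.
Qed.

Lemma bounded_periodic_powR p f : 0 <= p -> bounded_periodic f ->
  bounded_periodic (fun x => `|f x| `^ p).
Proof.
move=> p0 [mf [M fM] fT]; split; [|exists (M `^ p) => x|by move=> x; rewrite fT].
- apply: (@measurableT_comp _ _ _ _ _ _ (@powR R ^~ p)); first exact: measurable_powR.
  by apply: measurableT_comp mf; exact: normr_measurable.
- rewrite ger0_norm ?powR_ge0// ge0_ler_powR ?nnegrE//.
  exact: le_trans (fM x).
Qed.

Lemma bounded_periodic_shift a f : bounded_periodic f ->
  bounded_periodic (fun x => f (x + a)).
Proof.
move=> [mf [M fM] fT]; split; [|by exists M|by move=> x; rewrite addrAC fT].
by apply: measurableT_comp => //; exact: measurable_funD.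
Qed.

Lemma period_integralD f g : bounded_periodic f -> bounded_periodic g ->
  period_integral (fun x => f x + g x) = period_integral f + period_integral g.
Proof. by move=> bf bg; apply: RintegralD => //; exact: bounded_periodic_integrable. Qed.

Lemma period_integral_cst c : period_integral (cst c) = T * c.
Proof.
rewrite /period_integral Rintegral_cst//= lebesgue_measure_itv/= lte_fin T0.
by rewrite sube0/= mulrC.
Qed.

Lemma period_integral_sum (I : Type) (s : seq I) (f : I -> R -> R) :
  (forall i, bounded_periodic (f i)) ->
  period_integral (fun x => \sum_(i <- s) f i x) = \sum_(i <- s) period_integral (f i).
Proof.
move=> bf; elim: s => [|i s IHs].
  under [in LHS]eq_fun do rewrite big_nil.
  by rewrite big_nil period_integral_cst mulr0.
under [in LHS]eq_fun do rewrite big_cons.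
by rewrite big_cons period_integralD ?IHs//; exact: bounded_periodic_sum.
Qed.

Lemma le_period_integral f g : bounded_periodic f -> bounded_periodic g ->
  (forall x, f x <= g x) -> period_integral f <= period_integral g.
Proof.
by move=> bf bg fg; apply: le_Rintegral => //; exact: bounded_periodic_integrable.
Qed.

Lemma period_integral_shift a f : bounded_periodic f -> (forall x, 0 <= f x) ->
  period_integral (fun x => f (x + a)) = period_integral f.
Proof.
move=> [mf _ fT] f0; congr fine.
apply: (@ge0_integral_period_shift R T a (EFin \o f)) => //.
- exact/measurable_EFinP.
- by move=> x /=; rewrite fT.
Qed.

Lemma lt_period_integral f g a b : bounded_periodic f -> bounded_periodic g ->
  (forall x, f x <= g x) -> 0 <= a -> a < b -> b <= T ->
  (forall x, a < x < b -> f x < g x) -> period_integral f < period_integral g.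
Proof.
move=> bf bg fg a0 ab bT fgab.
rewrite -subr_gt0 -RintegralB//; [|exact: bounded_periodic_integrable..].
have ig : mu.-integrable `[0, T[ (EFin \o (fun x => g x - f x)).
  rewrite (_ : _ \o _ = (EFin \o g) \- (EFin \o f))%E//.
  by apply: integrableB => //; exact: bounded_periodic_integrable.
rewrite -lte_fin fineK; last exact: integrable_fin_num ig.
apply: (@integral_gt0 _ _ `]a, b[%classic) => //.
- by move=> x /=; rewrite !in_itv/=; lra.
- by rewrite /= lebesgue_measure_itv/= lte_fin ab -EFinB lte_fin subr_gt0.
- exact: measurable_int ig.
- by move=> x _; rewrite lee_fin subr_ge0.
- by move=> x /=; rewrite in_itv/= => xab; rewrite lte_fin subr_gt0 fgab.
Qed.

End PeriodIntegral.

(** * Staircases and separated sequences *)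

Section Staircase.
Context {R : realType}.
Implicit Types (S : R -> R) (X : int -> R).

(** Axiomatises the mollification of [floor (./T)]. By [staircase_gap], two arguments at distance
    [w] never lie inside the same rise between consecutive integers. *)
Record staircase (T : nat) (w : R) S : Prop := Staircase {
  staircase_homo : {homo S : x y / x <= y} ;
  staircase_period : forall z, S (z + T%:R) = S z + 1 ;
  staircase_gap : forall y z, y + w <= z -> exists m : int, S y <= m%:~R <= S z ;
  staircase_lipschitz : exists2 L, 0 <= L & forall x y, `|S x - S y| <= L * `|x - y| }.

(** Indexing the whole periodic point set by [int] makes the pairing of points a plain index shift,
    without wrap-around. *)
Record separated_sequence (T : nat) (w : R) X : Prop := SeparatedSequence {
  separated_period : forall n : int, X (n + T) = X n + T%:R ;
  separated_gap : forall n m : int, n < m -> X n + w <= X m }.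

(** Moving the index window by one exchanges [g l] for [g (l + T) = g l + c], so each unit of [k]
    contributes [c]. *)
Lemma sum_ord_int_shift (T : nat) (g : int -> R) (c : R) (k : int) : (0 < T)%N ->
  (forall n : int, g (n + T) = g n + c) ->
  \sum_(i < T) g ((i : nat)%:Z + k) = \sum_(i < T) g (i : nat) + k%:~R * c.
Proof.
case: T => [//|T] _ gT.
have step (l : int) : \sum_(i < T.+1) g ((i : nat)%:Z + (l + 1)) =
    \sum_(i < T.+1) g ((i : nat)%:Z + l) + c.
  rewrite big_ord_recr big_ord_recl /= add0r.
  have -> : T%:Z + (l + 1) = l + T.+1 by lia.
  rewrite gT addrCA addrA; congr (_ + _ + _).
  by apply: eq_bigr => i _; congr g; rewrite /bump/=; lia.
elim/int_ind: k => [|n IHn|n IHn].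
- by rewrite mul0r addr0; apply: eq_bigr => i _; rewrite addr0.
- rewrite (_ : n.+1%:Z = n%:Z + 1); last by lia.
  by rewrite step IHn intrD mulrDl mul1r addrA.
- have := step (- n.+1%:Z); rewrite (_ : - n.+1%:Z + 1 = - n%:Z); last by lia.
  rewrite IHn => /eqP; rewrite -subr_eq => /eqP <-.
  rewrite (_ : - n.+1%:Z = - n%:Z - 1); last by lia.
  by rewrite intrB mulrBl mul1r addrA.
Qed.

(** The comparison at a fixed shift: an identity for the lattice energy [e0], a lower bound for the
    energy [e] of a competitor, and Jensen's inequality [b <= s]. *)
Lemma le_add_cancel (a b c s e0 e : R) :
  a + b = e0 + c -> a + s <= e + c -> b <= s -> e0 <= e.
Proof. lra. Qed.

Lemma lt_add_cancel (a b c s e0 e : R) :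
  a + b = e0 + c -> a + s <= e + c -> b < s -> e0 < e.
Proof. lra. Qed.

Section StaircaseTheory.
Context (T : nat) (w : R) (S : R -> R).
Context (T0 : (0 < T)%N) (stS : staircase T w S).

(* Each gap condition puts an integer between two values of [S]; together with
   the period, these integers leave no room for the two strict inequalities. *)
Lemma staircase_no_crossing c c' e e' :
  c' + w <= c -> c + w <= c' + T%:R -> e' + w <= e -> e + w <= e' + T%:R ->
  S c < S e -> S e' < S c' -> False.
Proof.
move=> h1 h2 h3 h4 ce e'c'.
have [m /andP[c'm mc]] := staircase_gap stS h1.
have [n /andP[en ne']] := staircase_gap stS h4.
rewrite (staircase_period stS) in ne'.
have : (m < n)%R by rewrite -(ltr_int R); lra.
have : (n < m + 1)%R by rewrite -(ltr_int R) intrD; lra.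
lia.
Qed.

(** There would be integers with [m <= S a < S b <= n] and [n <= S a' + 1 < S b' + 1 <= m + 1], that
    is, [m < n < m + 1]. *)
Lemma staircase_no_two_rises a b a' b' : b' + w <= a -> b + w <= a' + T%:R ->
  S a < S b -> S a' < S b' -> False.
Proof.
move=> h1 h2 ab a'b'.
have [m /andP[c'm mc]] := staircase_gap stS h1.
have [n /andP[en ne']] := staircase_gap stS h2.
rewrite (staircase_period stS) in ne'.
have : (m < n)%R by rewrite -(ltr_int R); lra.
have : (n < m + 1)%R by rewrite -(ltr_int R) intrD; lra.
lia.
Qed.

(** The supremum of the points where [S] has not yet exceeded [S 0]. If it is 0, its translate [T]
    is taken instead, to be positive. Strict inequalities between integrals will be located near
    this point. *)
Lemma staircase_growth_point : exists t0 : R, [/\ 0 < t0, t0 <= T%:R &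
  forall d, 0 < d -> S (t0 - d) < S (t0 + d)].
Proof.
pose E := [set t | S t <= S 0].
have E0 : E 0 by rewrite /E/=.
have ubE : ubound E T%:R.
  move=> t Et; rewrite leNgt; apply/negP => /ltW /(staircase_homo stS).
  have := staircase_period stS 0; rewrite add0r => -> S1.
  have St : S t <= S 0 := Et; lra.
have hsE : has_sup E by split; [exists 0|exists T%:R].
pose s := sup E.
have s0 : 0 <= s by apply: ub_le_sup => //; exists T%:R.
have sT : s <= T%:R by apply: ge_sup => //; exists 0 => //.
have sgrow d : 0 < d -> S (s - d) <= S 0 /\ S 0 < S (s + d).
  move=> d0; split.
    have [t Et] := sup_adherent d0 hsE; rewrite -/s => /ltW/(staircase_homo stS).
    by move=> /le_trans; apply.
  rewrite ltNge; apply/negP => Esd.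
  have : s + d <= s by apply: ub_le_sup => //; exists T%:R.
  lra.
have [s1|sgt] := leP s 0.
  have s00 : s = 0 by apply/eqP; rewrite eq_le s1.
  exists T%:R; split; rewrite ?ltr0n// => d d0.
  have [] := sgrow d d0; rewrite s00 -[T%:R]add0r addrAC [_ + T%:R + d]addrAC.
  by rewrite !(staircase_period stS); lra.
by exists s; split=> // d d0; have [] := sgrow d d0; lra.
Qed.

Lemma staircase_increment_bounded_periodic d :
  bounded_periodic T%:R (fun t => S (t + d) - S t).
Proof.
have mS : measurable_fun setT S.
  by apply: nondecreasing_measurable => // x y xy; exact: (staircase_homo stS).
split.
- apply: measurable_funB => //.
  by apply: (measurableT_comp mS); exact: measurable_funD.
- have [L L0 SL] := staircase_lipschitz stS.
  by exists (L * `|d|) => x; rewrite (le_trans (SL _ _))// addrC addKr.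
- by move=> x; rewrite addrAC !(staircase_period stS); ring.
Qed.

(** * The cost of a single jump as a function of its displacement *)

Context (p : R).
Context (p1 : 1 < p).
Let phi (x : R) := `|x| `^ p.

Let p0 : 0 <= p. Proof. exact: le_trans (ltW p1). Qed.

Let phi_swc : strictly_wright_convex phi.
Proof. exact: strictly_wright_convex_normr_powR. Qed.

Let TR0 : 0 < T%:R :> R. Proof. by rewrite ltr0n. Qed.

Definition increment_cost (th d : R) : R :=
  period_integral T%:R (fun t => `|th - (S (t + d) - S t)| `^ p).

Lemma increment_cost_bounded_periodic th d :
  bounded_periodic T%:R (fun t => phi (th - (S (t + d) - S t))).
Proof.
apply: (bounded_periodic_powR p0).
apply: bounded_periodicD; first exact: bounded_periodic_cst.
exact/bounded_periodicN/staircase_increment_bounded_periodic.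
Qed.

Lemma increment_cost_shift th d a :
  period_integral T%:R (fun t => phi (th - (S (t + a + d) - S (t + a)))) =
  increment_cost th d.
Proof.
apply: (@period_integral_shift _ _ TR0 a _ (increment_cost_bounded_periodic th d)).
by move=> t; exact: powR_ge0.
Qed.

Let increment_cost_shift_bp th d a :
  bounded_periodic T%:R (fun t => phi (th - (S (t + a + d) - S (t + a)))).
Proof. exact: bounded_periodic_shift (increment_cost_bounded_periodic th d). Qed.

(* Translating two of the four integrands makes the inequality hold pointwise. *)
Let cost_pointwise th d a b t : 0 <= a -> 0 <= b ->
  phi (th - (S (t + b + (d + a)) - S (t + b))) + phi (th - (S (t + (d + b)) - S t)) <=
  phi (th - (S (t + b + d) - S (t + b))) + phi (th - (S (t + (d + a + b)) - S t)).
Proof.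
move=> a0 b0.
have := strictly_wright_convexW phi_swc (th - (S (t + (d + a + b)) - S t))
   (b := S (t + (d + a + b)) - S (t + b + d)) (a := S (t + b) - S t).
rewrite !subr_ge0 => H.
have {H} : _ := H ltac:(apply: (staircase_homo stS); lra) ltac:(apply: (staircase_homo stS); lra).
have -> : t + b + (d + a) = t + (d + a + b) by ring.
have -> : t + (d + b) = t + b + d by ring.
set A := S (t + b); set B := S t; set C := S (t + (d + a + b)); set D := S (t + b + d).
have -> : th - (C - B) + (A - B) = th - (C - A) by ring.
have -> : th - (C - B) + (C - D) = th - (D - B) by ring.
have -> : th - (C - A) + (C - D) = th - (D - A) by ring.
by rewrite [phi (th - (D - A)) + _]addrC.
Qed.

Lemma increment_cost_wright th : wright_convex (increment_cost th).
Proof.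
move=> d a b a0 b0.
(* The costs at [d + a] and [d] are translated by [b]; the other two stay in place. *)
rewrite -(increment_cost_shift th (d + a) b) -(increment_cost_shift th d b).
rewrite -(period_integralD (increment_cost_shift_bp th (d + a) b)
            (increment_cost_bounded_periodic th (d + b))).
rewrite -(period_integralD (increment_cost_shift_bp th d b)
            (increment_cost_bounded_periodic th (d + a + b))).
apply: le_period_integral.
- by apply: bounded_periodicD => //; exact: increment_cost_bounded_periodic.
- by apply: bounded_periodicD => //; exact: increment_cost_bounded_periodic.
- by move=> t; exact: cost_pointwise.
Qed.

(** Strictness in the pointwise inequality requires [S] to increase strictly on both [[t, t + b]]
    and [[t + th, t + th + a]]. This holds when both contain [[t0 - dl, t0 + dl]] around the growth
    point [t0]. *)
Lemma increment_cost_strict (m : R) : 0 < m -> exists2 dl : R, 0 < dl &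
  forall th a b, `|th| < dl -> m <= a -> m <= b ->
  increment_cost th th + increment_cost th (th + a - b) <
  increment_cost th (th + a) + increment_cost th (th - b).
Proof.
move=> m0; have [t0 [t00 t0T grow]] := staircase_growth_point.
(* For [t] between [t0 - 3 dl] and [t0 - 2 dl], left ends stay below [t0 - dl] although [th] may add
   [dl]. Right ends exceed [t0 - 4 dl + m], so [m >= 5 dl] suffices. The bound [dl <= t0 / 3] keeps
   these [t] in the period. *)
pose dl := Num.min (m / 5) (t0 / 3).
have dl0 : 0 < dl by rewrite lt_min; apply/andP; split; lra.
have dlm : dl <= m / 5 by rewrite ge_min lexx.
have dlt : dl <= t0 / 3 by rewrite ge_min lexx orbT.
exists dl => // th a b; rewrite ltr_norml => /andP[th1 th2] ma mb.
have a0 : 0 <= a by lra. have b0 : 0 <= b by lra.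
set d := th - b.
suff : increment_cost th (d + a) + increment_cost th (d + b) <
    increment_cost th d + increment_cost th (d + a + b).
  have -> : d + a + b = th + a by rewrite /d; ring.
  have -> : d + a = th + a - b by rewrite /d; ring.
  have -> : d + b = th by rewrite /d; ring.
  by rewrite [X in X < _ -> _]addrC [X in _ < X -> _]addrC.
rewrite -(increment_cost_shift th (d + a) b) -(increment_cost_shift th d b).
rewrite -(period_integralD (increment_cost_shift_bp th (d + a) b)
            (increment_cost_bounded_periodic th (d + b))).
rewrite -(period_integralD (increment_cost_shift_bp th d b)
            (increment_cost_bounded_periodic th (d + a + b))).
apply: (@lt_period_integral _ _ _ _ (t0 - 3 * dl) (t0 - 2 * dl)).
- by apply: bounded_periodicD => //; exact: increment_cost_bounded_periodic.
- by apply: bounded_periodicD => //; exact: increment_cost_bounded_periodic.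
- by move=> t; exact: cost_pointwise.
- lra.
- lra.
- lra.
move=> t /andP[t1 t2].
have grow2 x y : x <= t0 - dl -> t0 + dl <= y -> S x < S y.
  move=> hx hy; apply: le_lt_trans (lt_le_trans (grow _ dl0) _);
    exact: (staircase_homo stS).
have := phi_swc (th - (S (t + (d + a + b)) - S t))
   (b := S (t + (d + a + b)) - S (t + b + d)) (a := S (t + b) - S t).
rewrite !subr_gt0 => H.
have {H} : _ := H ltac:(apply: grow2; rewrite /d; lra) ltac:(apply: grow2; rewrite /d; lra).
have -> : t + b + (d + a) = t + (d + a + b) by ring.
have -> : t + (d + b) = t + b + d by ring.
set A := S (t + b); set B := S t; set C := S (t + (d + a + b)); set D := S (t + b + d).
have -> : th - (C - B) + (A - B) = th - (C - A) by ring.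
have -> : th - (C - B) + (C - D) = th - (D - B) by ring.
have -> : th - (C - A) + (C - D) = th - (D - A) by ring.
by rewrite [phi (th - (D - A)) + _]addrC.
Qed.

(** * Increments of the potential, paired jumps and the comparison with the lattice *)

Definition increment X (h x : R) : R :=
  h - \sum_(i < T) (S (x + h - X (i : nat)) - S (x - X (i : nat))).

Definition increment_energy X (h : R) : R :=
  period_integral T%:R (fun x => `|increment X h x| `^ p).

Definition paired_jump X (k : int) (h : R) (i : 'I_T) (x : R) :=
  S (x + h - X (i : nat)) - S (x - X ((i : nat)%:Z - k)).

(** Since [S (x - X (n + T)) = S (x - X n) - 1], shifting the indices by [-k] raises the sum of the
    [S (x - X i)] by [k], which is moved into the background [h - k]. *)
Lemma increment_paired_jump X k h x : (forall n : int, X (n + T) = X n + T%:R) ->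
  increment X h x = h - k%:~R - \sum_i paired_jump X k h i x.
Proof.
move=> Xper; rewrite /increment /paired_jump !sumrB.
have := @sum_ord_int_shift T (fun n => S (x - X n)) (-1) (- k) T0.
move=> -> => [|n].
  rewrite rmorphN/=; ring.
rewrite Xper -[x - X n](subrK T%:R) (staircase_period stS) addrK.
by congr S; ring.
Qed.

Let bp_jump X k h i : bounded_periodic T%:R (paired_jump X k h i).
Proof.
have := bounded_periodic_shift (- X ((i : nat)%:Z - k))
  (staircase_increment_bounded_periodic (h - X (i : nat) + X ((i : nat)%:Z - k))).
congr bounded_periodic; apply/funext => x; rewrite /paired_jump.
by congr (S _ - _); ring.
Qed.

Lemma paired_jump_cost X k h i th :
  period_integral T%:R (fun x => phi (th - paired_jump X k h i x)) =
  increment_cost th (h - X (i : nat) + X ((i : nat)%:Z - k)).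
Proof.
rewrite -(increment_cost_shift _ _ (- X ((i : nat)%:Z - k))).
congr (period_integral _ _); apply/funext => x; rewrite /paired_jump.
by congr (phi (_ - (S _ - _))); ring.
Qed.

Let bp_phi_jump X k h i th :
  bounded_periodic T%:R (fun x => phi (th - paired_jump X k h i x)).
Proof.
apply: (bounded_periodic_powR p0).
by apply: bounded_periodicD; [exact: bounded_periodic_cst|exact: bounded_periodicN].
Qed.

Let bp_phi_sum X k h th :
  bounded_periodic T%:R (fun x => phi (th - \sum_i paired_jump X k h i x)).
Proof.
apply: (bounded_periodic_powR p0).
apply: bounded_periodicD; first exact: bounded_periodic_cst.
by apply/bounded_periodicN/bounded_periodic_sum.
Qed.

(** A positive and a negative jump would be two index-ordered pairs of arguments whose [S] values
    change in opposite directions, excluded by [staircase_no_crossing]. *)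
Lemma paired_jump_same_sign X k h x : separated_sequence T w X ->
  (forall i, 0 <= paired_jump X k h i x) \/ (forall i, paired_jump X k h i x <= 0).
Proof.
move=> [Xper Xgap].
have aux (i j : 'I_T) : 0 < paired_jump X k h i x -> paired_jump X k h j x < 0 -> False.
  rewrite /paired_jump subr_gt0 subr_lt0 => ri fj.
  have gap2 (n m : int) : n < m -> X n + w <= X m by exact: Xgap.
  have gapT (n m : int) : m < n + T -> X m + w <= X n + T%:R.
    by rewrite -Xper; exact: Xgap.
  have lti := ltn_ord i; have ltj := ltn_ord j.
  have [ij|ji|/val_inj ij] := ltngtP i j; last by move: fj; rewrite -ij; lra.
  - have e1 : X ((i : nat)%:Z - k) + w <= X ((j : nat)%:Z - k) by apply: gap2; lia.
    have e2 : X ((j : nat)%:Z - k) + w <= X ((i : nat)%:Z - k) + T%:R by apply: gapT; lia.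
    have e3 : X (i : nat) + w <= X (j : nat) by apply: gap2; lia.
    have e4 : X (j : nat) + w <= X (i : nat) + T%:R by apply: gapT; lia.
    by apply: (staircase_no_crossing _ _ _ _ ri fj); lra.
  (* For [j < i] the rise of [i] is moved up by one period, which restores the order of the first
     case. *)
  - have ri' : S (x - X ((i : nat)%:Z - k) + T%:R) < S (x + h - X (i : nat) + T%:R).
      by rewrite !(staircase_period stS) ltrD2r.
    have e1 : X ((j : nat)%:Z - k) + w <= X ((i : nat)%:Z - k) by apply: gap2; lia.
    have e2 : X ((i : nat)%:Z - k) + w <= X ((j : nat)%:Z - k) + T%:R by apply: gapT; lia.
    have e3 : X (j : nat) + w <= X (i : nat) by apply: gap2; lia.
    have e4 : X (i : nat) + w <= X (j : nat) + T%:R by apply: gapT; lia.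
    by apply: (staircase_no_crossing _ _ _ _ ri' fj); lra.
have [?|/existsNP[i /negP]] := pselect (forall i, 0 <= paired_jump X k h i x); first by left.
rewrite -ltNge => bi; right => j; rewrite leNgt; apply/negP => bj.
exact: aux bj bi.
Qed.

(** The same-sign inequality integrated over a period. In [T * (T * phi)] one factor is the length
    of the period, the other the number of points. *)
Lemma increment_energy_ge X k h : separated_sequence T w X ->
  T%:R * phi (h - k%:~R) +
    \sum_(i < T) increment_cost (h - k%:~R) (h - X (i : nat) + X ((i : nat)%:Z - k)) <=
  increment_energy X h + T%:R * (T%:R * phi (h - k%:~R)).
Proof.
move=> sX; set th := h - k%:~R.
rewrite -(period_integral_cst TR0 (T%:R * phi th)) -[X in X + _ <= _](period_integral_cst TR0).
under eq_bigr do rewrite -paired_jump_cost.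
have -> : increment_energy X h =
    period_integral T%:R (fun x => phi (th - \sum_i paired_jump X k h i x)).
  congr (period_integral _ _); apply/funext => x.
  by rewrite (increment_paired_jump k)//; case: sX.
have bs := bounded_periodic_sum (index_enum 'I_T) (fun i => bp_phi_jump X k h i th).
have sE := period_integral_sum TR0 (index_enum 'I_T) (fun i => bp_phi_jump X k h i th).
rewrite -sE -(period_integralD (bounded_periodic_cst T%:R (phi th)) bs).
rewrite -(period_integralD (bp_phi_sum X k h th)
            (bounded_periodic_cst T%:R (T%:R * phi th))).
apply: le_period_integral.
- by apply: bounded_periodicD; [exact: bounded_periodic_cst|exact: bounded_periodic_sum].
- by apply: bounded_periodicD => //; exact: bounded_periodic_cst.
move=> x; have := wright_convex_same_sign_sum th (strictly_wright_convexW phi_swc)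
  (paired_jump_same_sign k h x sX).
by rewrite card_ord.
Qed.

(** On the lattice the two arguments of every jump differ by [h - k], at most [1/2] in size.
    Different indices are 1 apart modulo [T], which leaves a distance of at least [1/2 >= w] between
    their intervals, so [staircase_no_two_rises] applies. *)
Lemma lattice_single_jump k h x (i j : 'I_T) : w <= 2^-1 -> `|h - k%:~R| <= 2^-1 ->
  i != j -> paired_jump intr k h i x != 0 -> paired_jump intr k h j x = 0.
Proof.
move=> w2; rewrite ler_norml => /andP[th1 th2].
wlog ij : i j / (i < j)%N.
  move=> H ij bi; have [lt|gt|/val_inj eij] := ltngtP i j.
  - exact: (H i j).
  - apply/eqP/negPn/negP => bj; have := H j i gt; rewrite eq_sym => /(_ ij bj) b0.
    by rewrite b0 eqxx in bi.
  - by rewrite eij eqxx in ij.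
move=> _ bi; apply/eqP/negPn/negP => bj; move: bi bj; rewrite /paired_jump !subr_eq0.
have hij : (i : nat)%:~R + 1 <= (j : nat)%:~R :> R.
  by rewrite -[1]/(1%:~R) -intrD ler_int; lia.
have hji : (j : nat)%:~R + 1 <= (i : nat)%:~R + T%:R :> R.
  rewrite -[1]/(1%:~R) -[T%:R]/(T%:~R) -!intrD ler_int; have := ltn_ord j; lia.
rewrite !intrD !rmorphN/=.
(* The sign of [h - k] decides which end of each interval is the left one. *)
have [th0|th0] := leP 0 (h - k%:~R) => bi bj.
- apply: (@staircase_no_two_rises (x - ((i : nat)%:~R - k%:~R)) (x + h - (i : nat)%:~R)
    (x - ((j : nat)%:~R - k%:~R)) (x + h - (j : nat)%:~R)); try lra.
  + by rewrite lt_neqAle eq_sym bi/=; apply: (staircase_homo stS); lra.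
  + by rewrite lt_neqAle eq_sym bj/=; apply: (staircase_homo stS); lra.
- apply: (@staircase_no_two_rises (x + h - (i : nat)%:~R) (x - ((i : nat)%:~R - k%:~R))
    (x + h - (j : nat)%:~R) (x - ((j : nat)%:~R - k%:~R))); try lra.
  + by rewrite lt_neqAle bi/=; apply: (staircase_homo stS); lra.
  + by rewrite lt_neqAle bj/=; apply: (staircase_homo stS); lra.
Qed.

Lemma lattice_period (n : int) : (n + T)%:~R = n%:~R + T%:R :> R.
Proof. by rewrite intrD. Qed.

(** Equality in [increment_energy_ge]: with at most one nonzero jump at each [x], both integrands
    agree term by term. *)
Lemma lattice_increment_energy k h : w <= 2^-1 -> `|h - k%:~R| <= 2^-1 ->
  T%:R * phi (h - k%:~R) + T%:R * increment_cost (h - k%:~R) (h - k%:~R) =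
  increment_energy intr h + T%:R * (T%:R * phi (h - k%:~R)).
Proof.
move=> w2 th2; set th := h - k%:~R.
have -> : T%:R * increment_cost th th =
    \sum_(i < T) period_integral T%:R (fun x => phi (th - paired_jump intr k h i x)).
  rewrite -[in LHS](card_ord T) mulr_natl -sumr_const; apply: eq_bigr => i _.
  by rewrite paired_jump_cost; congr increment_cost; rewrite intrD rmorphN/= /th; ring.
rewrite -(period_integral_cst TR0 (T%:R * phi th)) -[X in X + _ = _](period_integral_cst TR0).
have -> : increment_energy intr h =
    period_integral T%:R (fun x => phi (th - \sum_i paired_jump intr k h i x)).
  congr (period_integral _ _); apply/funext => x.
  by rewrite (increment_paired_jump k)//; exact: lattice_period.
have bs := bounded_periodic_sum (index_enum 'I_T) (fun i => bp_phi_jump intr k h i th).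
have sE := period_integral_sum TR0 (index_enum 'I_T) (fun i => bp_phi_jump intr k h i th).
rewrite -sE -(period_integralD (bounded_periodic_cst T%:R (phi th)) bs).
rewrite -(period_integralD (bp_phi_sum intr k h th)
            (bounded_periodic_cst T%:R (T%:R * phi th))).
congr (period_integral _ _); apply/funext => x /=.
have [[i0 bi0]|/forallNP all0] := pselect (exists i, paired_jump intr k h i x != 0).
  have b0 i : i != i0 -> paired_jump intr k h i x = 0.
    by move=> ii0; apply: lattice_single_jump bi0; rewrite // eq_sym.
  rewrite (bigD1 i0)//= [in RHS](bigD1 i0)//= [in RHS]big1// addr0 addrCA; congr (_ + _).
  under eq_bigr => i /b0 -> do rewrite subr0.
  rewrite sumr_const cardC1 card_ord -[in RHS](prednK T0) -natr1 mulrDl mul1r addrC.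
  by rewrite mulr_natl.
have {}all0 i : paired_jump intr k h i x = 0 by apply/eqP/negPn/negP/all0.
rewrite [in RHS]big1// subr0; congr (_ + _).
under eq_bigr do rewrite all0 subr0.
by rewrite sumr_const card_ord mulr_natl.
Qed.

Lemma nearest_int (h : R) : exists k : int, `|h - k%:~R| <= 2^-1.
Proof.
exists (Num.floor (h + 2^-1)).
have := @Num.Theory.floor_itv R (h + 2^-1); rewrite intrD ler_norml => /andP[]; lra.
Qed.

Lemma sum_displacement X k h : separated_sequence T w X ->
  \sum_(i < T) (h - X (i : nat) + X ((i : nat)%:Z - k)) = T%:R * (h - k%:~R).
Proof.
move=> [Xper _]; rewrite big_split/= sumrB sumr_const card_ord.
rewrite (@sum_ord_int_shift T X T%:R (- k) T0 Xper) rmorphN/= -mulr_natl; ring.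
Qed.

Lemma lattice_energy_le X h : w <= 2^-1 -> separated_sequence T w X ->
  increment_energy intr h <= increment_energy X h.
Proof.
move=> w2 sX; have [k hk] := nearest_int h.
apply: le_add_cancel (lattice_increment_energy w2 hk) (increment_energy_ge k h sX) _.
exact: wright_convex_jensen (increment_cost_wright _) (sum_displacement k h sX).
Qed.

(** For [h] near 1 the pairing [k = 1] has displacements [h - 1 + (1 - gap i)]. Non-unit gaps keep
    these away from their mean [h - 1], by an amount independent of [h]. *)
Lemma lattice_energy_lt X : w <= 2^-1 -> separated_sequence T w X ->
  (exists i : 'I_T, X (i : nat) - X ((i : nat)%:Z - 1) != 1) ->
  exists2 dl : R, 0 < dl & forall h, `|h - 1| < dl ->
    increment_energy intr h < increment_energy X h.
Proof.
move=> w2 sX [i0 gi0].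
pose gap (i : 'I_T) := X (i : nat) - X ((i : nat)%:Z - 1).
have [m m0 hm] : exists2 m : R, 0 < m & forall i, gap i != 1 -> m <= `|gap i - 1|.
  (* The smallest deviation of a non-unit gap, capped by the default value 1. *)
  exists (\big[Order.min/1]_(i | gap i != 1) `|gap i - 1|).
    by apply/bigmin_gtP; split=> // i; rewrite normr_gt0 subr_eq0.
  by move=> i gi; exact: bigmin_le_cond.
have [dl dl0 hdl] := increment_cost_strict m0.
(* The bound [1/2] makes the lattice identity available with [k = 1]. *)
exists (Num.min dl 2^-1); first by rewrite lt_min dl0; lra.
move=> h; rewrite lt_min => /andP[h1 h2].
have hk : `|h - 1%:~R| <= 2^-1 by exact: ltW.
have dE (i : 'I_T) : h - X (i : nat) + X ((i : nat)%:Z - 1) = h - 1%:~R + (1 - gap i).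
  by rewrite /gap; ring.
apply: lt_add_cancel (lattice_increment_energy w2 hk) (increment_energy_ge 1 h sX) _.
apply: wright_convex_jensen_lt.
- exact: increment_cost_wright.
- move=> i j; rewrite !dE => ci cj.
  have mi : m <= 1 - gap i.
    have := hm i; rewrite ltr0_norm ?opprB; last by lra.
    by apply; apply/eqP; lra.
  have mj : m <= gap j - 1.
    have := hm j; rewrite gtr0_norm; last by lra.
    by apply; apply/eqP; lra.
  have := hdl (h - 1%:~R) _ _ h1 mi mj.
  have -> : h - 1%:~R + (1 - gap i) - (gap j - 1) =
      h - 1%:~R + (1 - gap i) + (h - 1%:~R + (1 - gap j)) - (h - 1%:~R) by ring.
  by have -> : h - 1%:~R - (gap j - 1) = h - 1%:~R + (1 - gap j) by ring.
- exact: sum_displacement.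
- exists i0; rewrite dE; apply: contra gi0 => /eqP e; apply/eqP; rewrite -/(gap i0); lra.
Qed.

End StaircaseTheory.
End Staircase.

(** * Mollification of the floor function *)

Section Mollification.
Context {R : realType}.
Notation mu := (@lebesgue_measure R).

Record is_kernel (w M : R) (r : R -> R) : Prop := IsKernel {
  kernel_ge0 : forall x, 0 <= r x ;
  kernel_le : forall x, r x <= M ;
  kernel_support : forall x, w <= `|x| -> r x = 0 ;
  kernel_measurable : measurable_fun setT r ;
  kernel_mass : (\int[mu]_x (r x)%:E = 1)%E }.

Definition kernel_mean (r g : R -> R) : R := \int[mu]_x (g x * r x).

(** Bounds are asked only where the kernel lives: [floor] and the identity are unbounded on the
    line. *)
Definition bounded_on_ball (w : R) (g : R -> R) : Prop :=
  measurable_fun setT g /\ exists C, forall x, `|x| < w -> `|g x| <= C.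

Section KernelMean.
Context (w M : R) (r : R -> R).
Context (kr : is_kernel w M r).
Implicit Types g f : R -> R.

Lemma kernel_integrable : mu.-integrable setT (EFin \o r).
Proof.
apply/integrableP; split; first by apply/measurable_EFinP; exact: (kernel_measurable kr).
under eq_integral => x _ do rewrite /= ger0_norm ?(kernel_ge0 kr)//.
by rewrite (kernel_mass kr) ltry.
Qed.

Lemma bounded_on_ball_integrable g : bounded_on_ball w g ->
  mu.-integrable setT (EFin \o (fun x => g x * r x)).
Proof.
move=> [mg [C gC]].
apply: (@le_integrable _ _ R mu setT measurableT _ (fun x => (`|C| * r x)%:E)) => //.
- by apply/measurable_EFinP; apply: measurable_funM => //; exact: kernel_measurable kr.
- move=> x _ /=; rewrite lee_fin !normrM normr_id.
  have [xw|xw] := ltP `|x| w; last by rewrite (kernel_support kr)// normr0 !mulr0.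
  by rewrite ler_wpM2r// (le_trans (gC x xw))// ler_norm.
- under eq_fun do rewrite EFinM.
  by apply: integrableZl => //; exact: kernel_integrable.
Qed.

Lemma bounded_on_ballD f g : bounded_on_ball w f -> bounded_on_ball w g ->
  bounded_on_ball w (fun x => f x + g x).
Proof.
move=> [mf [C fC]] [mg [D gD]]; split; first exact: measurable_funD.
by exists (C + D) => x xw; rewrite (le_trans (ler_normD _ _))// lerD ?fC ?gD.
Qed.

Lemma bounded_on_ballN f : bounded_on_ball w f -> bounded_on_ball w (fun x => - f x).
Proof.
move=> [mf [C fC]]; split; first exact: measurable_funN.
by exists C => x xw; rewrite normrN fC.
Qed.

Lemma bounded_on_ball_cst c : bounded_on_ball w (cst c).
Proof. by split => //; exists `|c|. Qed.

Lemma bounded_on_ball_id : bounded_on_ball w id.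
Proof. by split => //; exists w => x /ltW. Qed.

Lemma bounded_on_ball_sum (I : Type) (s : seq I) (f : I -> R -> R) :
  (forall i, bounded_on_ball w (f i)) -> bounded_on_ball w (fun x => \sum_(i <- s) f i x).
Proof.
move=> bf; elim: s => [|i s IHs].
  under eq_fun do rewrite big_nil; exact: bounded_on_ball_cst.
under eq_fun do rewrite big_cons; exact: bounded_on_ballD.
Qed.

Lemma kernel_meanD f g : bounded_on_ball w f -> bounded_on_ball w g ->
  kernel_mean r (fun x => f x + g x) = kernel_mean r f + kernel_mean r g.
Proof.
move=> bf bg; rewrite /kernel_mean -RintegralD//; try exact: bounded_on_ball_integrable.
by under eq_Rintegral do rewrite mulrDl.
Qed.

Lemma kernel_mean_cst c : kernel_mean r (cst c) = c.
Proof.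
rewrite /kernel_mean RintegralZl//; last exact: kernel_integrable.
by rewrite /Rintegral (kernel_mass kr) mulr1.
Qed.

Lemma kernel_meanN f : bounded_on_ball w f ->
  kernel_mean r (fun x => - f x) = - kernel_mean r f.
Proof.
move=> bf; have := kernel_meanD bf (bounded_on_ballN bf).
under [X in kernel_mean _ X]eq_fun do rewrite subrr.
rewrite (kernel_mean_cst 0) => /esym/eqP; rewrite addrC addr_eq0 => /eqP ->//.
Qed.

Lemma kernel_mean_sum (I : Type) (s : seq I) (f : I -> R -> R) :
  (forall i, bounded_on_ball w (f i)) ->
  kernel_mean r (fun x => \sum_(i <- s) f i x) = \sum_(i <- s) kernel_mean r (f i).
Proof.
move=> bf; elim: s => [|i s IHs].
  by under [X in kernel_mean _ X]eq_fun do rewrite big_nil; rewrite big_nil kernel_mean_cst.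
under [X in kernel_mean _ X]eq_fun do rewrite big_cons.
by rewrite big_cons kernel_meanD ?IHs//; exact: bounded_on_ball_sum.
Qed.

Lemma le_kernel_mean f g : bounded_on_ball w f -> bounded_on_ball w g ->
  (forall x, `|x| < w -> f x <= g x) -> kernel_mean r f <= kernel_mean r g.
Proof.
move=> bf bg fg; apply: le_Rintegral => //; try exact: bounded_on_ball_integrable.
move=> x _; have [xw|xw] := ltP `|x| w; last by rewrite (kernel_support kr)// !mulr0.
by rewrite ler_wpM2r ?fg ?(kernel_ge0 kr).
Qed.

Let integrable_indic_itv (a b : R) :
  mu.-integrable setT (EFin \o (\1_(`]a, b]%classic) : R -> R)).
Proof.
apply/integrableP; split; first exact/measurable_EFinP/measurable_indic.
under eq_integral => x _ do rewrite /= ger0_norm//.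
rewrite integral_indic// setIT /= lebesgue_measure_itv/=.
by case: ifP => _; rewrite ?ltry// -EFinB ltry.
Qed.

Lemma kernel_mean_indic (a b : R) : a <= b ->
  kernel_mean r \1_(`]a, b]%classic) <= M * (b - a).
Proof.
move=> ab.
have mA : measurable (`]a, b]%classic : set R) by [].
have -> : M * (b - a) = \int[mu]_x (M * \1_(`]a, b]%classic) x).
  rewrite RintegralZl//; congr (_ * _).
  rewrite /Rintegral integral_indic// setIT /= lebesgue_measure_itv/= lte_fin.
  by case: ltP => [_|ba] //=; lra.
apply: le_Rintegral => //.
- apply: bounded_on_ball_integrable; split; first exact: measurable_indic.
  by exists 1 => x _; rewrite indicE; case: (_ \in _); rewrite /= ?normr1 ?normr0.
- rewrite (_ : _ \o _ = (fun x => M%:E * (\1_(`]a, b]%classic) x)%:E)%E); last first.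
    by apply/funext => x /=; rewrite EFinM.
  by apply: integrableZl => //; exact: integrable_indic_itv.
- by move=> x _; rewrite mulrC ler_wpM2r ?(kernel_le kr).
Qed.

End KernelMean.

(** The convolution of [floor (./T)] with [r]. *)
Definition mollified_floor (T : nat) (r : R -> R) (z : R) : R :=
  kernel_mean r (fun y => (Num.floor ((z - y) / T%:R))%:~R).

(** * The mollified floor is a staircase *)

Section MollifiedFloor.
Context (w M : R) (r : R -> R) (T : nat).
Context (kr : is_kernel w M r) (w0 : 0 < w) (w4 : w <= 4^-1) (T0 : (0 < T)%N).
Let fl (z y : R) : R := (Num.floor ((z - y) / T%:R))%:~R.

Let T1 : 1 <= @GRing.natmul R 1 T. Proof. by rewrite ler1n. Qed.

Let fl_itv z y : fl z y * T%:R <= z - y < (fl z y + 1) * T%:R.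
Proof.
have TR0 : 0 < T%:R :> R by rewrite ltr0n.
have := @Num.Theory.floor_itv R ((z - y) / T%:R).
by rewrite intrD -/(fl z y) ler_pdivlMr// ltr_pdivrMr.
Qed.

Let fl_homo z z' y y' : z - y <= z' - y' -> fl z y <= fl z' y'.
Proof.
move=> h; rewrite /fl ler_int; apply: le_floor.
by rewrite ler_wpM2r// invr_ge0; lra.
Qed.

Let fl_int z y (m : int) : fl z y < m%:~R + 1 -> m%:~R < fl z y + 1 -> fl z y = m%:~R.
Proof.
rewrite /fl -[1]/(1%:~R) -!intrD !ltr_int => h1 h2; congr _%:~R; lia.
Qed.

Lemma floor_shift_bounded_on_ball z : bounded_on_ball w (fl z).
Proof.
split.
  by apply: nonincreasing_measurable => // x y xy; apply: fl_homo; lra.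
exists (`|fl z w| + `|fl z (- w)|) => x; rewrite ltr_norml => /andP[x1 x2].
have h1 : fl z w <= fl z x by apply: fl_homo; lra.
have h2 : fl z x <= fl z (- w) by apply: fl_homo; lra.
have := ler_norm (fl z (- w)); have := ler_norm (- fl z w); rewrite normrN => h3 h4.
have := normr_ge0 (fl z w); have := normr_ge0 (fl z (- w)) => h5 h6.
rewrite ler_norml; apply/andP; split; lra.
Qed.

Let bfl := floor_shift_bounded_on_ball.

Lemma mollified_floor_homo : {homo mollified_floor T r : x y / x <= y}.
Proof.
move=> x y xy; apply: (le_kernel_mean kr (bfl x) (bfl y)) => z _.
by apply: fl_homo; lra.
Qed.

Lemma mollified_floor_period z : mollified_floor T r (z + T%:R) = mollified_floor T r z + 1.
Proof.
have t1 := T1.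
have E := kernel_meanD kr (bfl z) (bounded_on_ball_cst w 1).
rewrite (kernel_mean_cst kr) in E; apply: etrans E.
congr (kernel_mean _ _); apply/funext => y /=.
rewrite (_ : (z + T%:R - y) / T%:R = (z - y) / T%:R + 1).
  by rewrite floorDrz// floor1 intrD.
by field; lra.
Qed.

(** For [|x| < w] one has [y - x < y + w <= z - w < z - x], so the floor at [z - w] separates all
    values averaged at [y] from those averaged at [z]. *)
Lemma mollified_floor_gap y z : y + 2 * w <= z ->
  exists m : int, mollified_floor T r y <= m%:~R <= mollified_floor T r z.
Proof.
move=> yz; exists (Num.floor ((z - w) / T%:R)).
rewrite -(kernel_mean_cst kr _%:~R); apply/andP; split.
- apply: (le_kernel_mean kr (bfl y) (bounded_on_ball_cst w _)) => x.
  by rewrite ltr_norml => /andP[x1 x2]; apply: fl_homo; lra.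
- apply: (le_kernel_mean kr (bounded_on_ball_cst w _) (bfl z)) => x.
  by rewrite ltr_norml => /andP[x1 x2]; apply: fl_homo; lra.
Qed.

(* For [0 <= h <= 1/2] at most one multiple [m T] can lie between [z - y] and
   [z + h - y] with [|y| < w], so the increment of the floor is an indicator. *)
Let mollified_floor_small z h : 0 <= h <= 2^-1 ->
  mollified_floor T r (z + h) - mollified_floor T r z <= M * h.
Proof.
(* [m] is the largest floor value in the window. The indicator is that of []z - m T, z + h - m T]],
   the set of [y] with [z - y < m T <= z + h - y]. *)
move=> /andP[h0 h2]; have t1 := T1; have w4' := w4; set m := fl (z + h) (- w).
have -> : M * h = M * (z + h - m * T%:R - (z - m * T%:R)) by congr (_ * _); ring.
apply: le_trans (kernel_mean_indic kr _); last by lra.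
rewrite -(kernel_meanN kr (bfl z)).
rewrite -(kernel_meanD kr (bfl (z + h)) (bounded_on_ballN (bfl z))).
apply: (le_kernel_mean kr).
- by apply: bounded_on_ballD; [exact: bfl|exact/bounded_on_ballN/bfl].
- split; first exact: measurable_indic.
  by exists 1 => x _; rewrite indicE; case: (_ \in _); rewrite /= ?normr1 ?normr0.
move=> y; rewrite ltr_norml => /andP[y1 y2]; rewrite -/(fl _ _) -/(fl _ _).
have hab : fl z y <= fl (z + h) y by apply: fl_homo; lra.
have hbm : fl (z + h) y <= m by apply: fl_homo; lra.
have /andP[a1 a2] := fl_itv z y; have /andP[b1 b2] := fl_itv (z + h) y.
have /andP[m1 m2] := fl_itv (z + h) (- w).
rewrite -/m in m1 m2.
have [->|ab] := eqVneq (fl (z + h) y) (fl z y); first by rewrite subrr indicE.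
have {hab}ab : fl z y + 1 <= fl (z + h) y.
  have : fl z y < fl (z + h) y by rewrite lt_neqAle eq_sym ab.
  by rewrite /fl ltr_int -lezD1 -(ler_int R) intrD.
have lt1 (u v : R) : u * T%:R < v * T%:R -> u < v by rewrite ltr_pM2r//; lra.
have le1 (u v : R) : u <= v -> u * T%:R <= v * T%:R by rewrite ler_pM2r//; lra.
have ab' := le1 _ _ ab.
have bm : fl (z + h) y = m.
  apply: fl_int; first by lra.
  by rewrite -/(fl _ _) -/m; apply: lt1; rewrite [ltRHS]mulrDl mul1r; lra.
have am : fl z y + 1 = m.
  have : fl z y = (Num.floor ((z + h - - w) / T%:R) - 1)%:~R.
    apply: fl_int; rewrite intrB -/(fl _ _) -/m; first by lra.
    by apply: lt1; rewrite [ltLHS]mulrBl [ltRHS]mulrDl !mul1r; lra.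
  by rewrite intrB -/(fl _ _) -/m; lra.
rewrite indicE mem_set/=; first by rewrite bm; lra.
rewrite in_itv/=; apply/andP; split; last by rewrite -bm; lra.
by rewrite -am; lra.
Qed.

Let M0 : 0 <= M. Proof. exact: le_trans (kernel_ge0 kr 0) (kernel_le kr 0). Qed.

(** The bound for steps of length at most [1/2] is added up along [[y, x]]. *)
Lemma mollified_floor_lipschitz x y :
  `|mollified_floor T r x - mollified_floor T r y| <= M * `|x - y|.
Proof.
wlog yx : x y / y <= x.
  move=> H; have [|/ltW] := leP y x; first exact: H.
  by rewrite distrC [`|x - y|]distrC; exact: H.
rewrite !ger0_norm ?subr_ge0//; last exact: mollified_floor_homo.
suff H (n : nat) z h : 0 <= h <= n%:R / 2 ->
    mollified_floor T r (z + h) - mollified_floor T r z <= M * h.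
  have h0 : 0 <= 2 * (x - y) by lra.
  have := archi_boundP h0; set n := Num.bound _ => hn.
  have := H n y (x - y); rewrite subrKC; apply; lra.
elim: n z h => [|n IHn] z h /andP[h0 hn].
  have -> : h = 0 by lra.
  by rewrite addr0 subrr mulr0.
have [h2|h2] := leP h 2^-1; first by apply: mollified_floor_small; rewrite h0.
have := IHn (z + 2^-1) (h - 2^-1); rewrite -natr1 in hn.
rewrite -addrA subrKC => H1.
have {}H1 := H1 ltac:(lra).
have H2 := @mollified_floor_small z 2^-1 ltac:(lra).
have -> : M * h = M * (h - 2^-1) + M * 2^-1 by ring.
lra.
Qed.

Lemma staircase_mollified_floor : staircase T (2 * w) (mollified_floor T r).
Proof.
split.
- exact: mollified_floor_homo.
- exact: mollified_floor_period.
- exact: mollified_floor_gap.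
- by exists M => //; exact: mollified_floor_lipschitz.
Qed.

End MollifiedFloor.

End Mollification.

(** * Integrals of difference quotients *)

Section DifferenceQuotient.
Context {R : realType}.
Notation mu := (@lebesgue_measure R).
Context (T p q : R) (u : R -> R).
Context (p0 : 0 <= p) (mu_u : measurable_fun setT u)
  (bu : forall h, bounded_periodic T (fun x => u (x + h) - u x)).

Definition difference_energy (h : R) : R :=
  period_integral T (fun x => `|u (x + h) - u x| `^ p).

Let f (z : R * R) : \bar R :=
  (`|u (z.1 + z.2) - u z.1| `^ p / `|z.2| `^ q)%:E.

Let f_ge0 z : (0 <= f z)%E.
Proof. by rewrite lee_fin divr_ge0// powR_ge0. Qed.

Let mf : measurable_fun setT f.
Proof.
have mpow (a : R) (g : R * R -> R) : measurable_fun setT g ->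
    measurable_fun setT (fun z => `|g z| `^ a).
  move=> mg; apply: (@measurableT_comp _ _ _ _ _ _ (@powR R ^~ a)).
    exact: measurable_powR.
  by apply: measurableT_comp mg; exact: normr_measurable.
have minv (g : R * R -> R) : measurable_fun setT g -> (forall z, 0 <= g z) ->
    measurable_fun setT (fun z => (g z)^-1).
  move=> mg g0; under eq_fun do rewrite -powR_inv1//.
  by apply: (@measurableT_comp _ _ _ _ _ _ (@powR R ^~ (-1))) => //; exact: measurable_powR.
apply/measurable_EFinP; apply: measurable_funM.
- apply: mpow; apply: measurable_funB.
    by apply: (measurableT_comp mu_u); apply: measurable_funD => //; exact: measurable_snd.
  by apply: (measurableT_comp mu_u); exact: measurable_fst.
- by apply: minv => [|z]; [exact: mpow|exact: powR_ge0].
Qed.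

(** The indicator of the period turns the energy into an integral over the whole plane, as Tonelli's
    theorem asks. *)
Let g (z : R * R) : \bar R := ((\1_(`[0, T[%classic) z.1)%:E * f z)%E.

Let g_ge0 z : (0 <= g z)%E.
Proof. by rewrite mule_ge0// lee_fin indicE ler0n. Qed.

Let mg : measurable_fun setT g.
Proof.
apply: emeasurable_funM => //; apply/measurable_EFinP.
apply: (measurableT_comp (measurable_indic _)) => //; exact: measurable_fst.
Qed.

Let inner (h : R) :
  (\int[mu]_x g (x, h) = ((`|h| `^ q)^-1 * difference_energy h)%:E)%E.
Proof.
have bp : bounded_periodic T (fun x => `|u (x + h) - u x| `^ p).
  by apply: bounded_periodic_powR.
transitivity (\int[mu]_(x in `[0%R, T[) f (x, h))%E.
  rewrite [RHS]integral_mkcond; apply: eq_integral => x _.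
  by rewrite /g /= patchE indicE; case: ifP => _; rewrite ?mul1e ?mul0e.
rewrite EFinM fineK; last exact: integrable_fin_num (bounded_periodic_integrable bp).
rewrite -ge0_integralZl_EFin//.
- by apply: eq_integral => x _; rewrite /f /= EFinM muleC.
- exact: measurable_int (bounded_periodic_integrable bp).
Qed.

Lemma measurable_difference_energy :
  measurable_fun setT (fun h : R => ((`|h| `^ q)^-1 * difference_energy h)%:E).
Proof.
under eq_fun do rewrite -inner.
exact: measurable_fun_fubini_tonelli_G.
Qed.

(** Substitution [y = x + h] in the inner integral, then Tonelli. Everything is nonnegative, so the
    identity holds in the extended reals before finiteness is known. *)
Lemma integral_difference_quotient :
  (\int[mu]_(x in `[0%R, T[) \int[mu]_y
     ((`|u x - u y| `^ p) / (`|x - y| `^ q))%:E =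
   \int[mu]_h ((`|h| `^ q)^-1 * difference_energy h)%:E)%E.
Proof.
under [RHS]eq_integral do rewrite -inner.
apply: etrans (fubini_tonelli (m1 := mu) (m2 := mu) g mg g_ge0).
rewrite integral_mkcond; apply: eq_integral => x _.
rewrite patchE; case: ifPn => xD; last first.
  by rewrite integral0_eq// => y _; rewrite /g /= indicE (negbTE xD) mul0e.
have -> : (\int[mu]_y g (x, y) = \int[mu]_y f (x, y))%E.
  by apply: eq_integral => y _; rewrite /g /= indicE xD mul1e.
pose k (y : R) : \bar R := ((`|u x - u y| `^ p) / (`|x - y| `^ q))%:E.
have mk : measurable_fun setT k.
  have : measurable_fun setT (fun y : R => f (x, y - x)).
    apply: (measurableT_comp mf); apply: measurable_fun_pair => //.
    exact: measurable_funB.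
  congr measurable_fun; apply/funext => y; rewrite /f /k /= subrKC distrC.
  by rewrite [`|y - x|]distrC.
have k0 y : setT y -> (0 <= k y)%E by rewrite lee_fin divr_ge0// powR_ge0.
rewrite -/(integral mu setT k) -(ge0_integral_shift x measurableT mk k0) preimage_setT.
apply: eq_integral => y _; rewrite /k /f /= [y + x]addrC distrC.
by rewrite opprD addrA subrr sub0r normrN.
Qed.

End DifferenceQuotient.

(** * Integrability at zero and at infinity *)

Section Finiteness.
Context {R : realType}.
Notation mu := (@lebesgue_measure R).

Lemma powR_continuous_gt0 (a x : R) : 0 < x -> {for x, continuous (@powR R ^~ a)}.
Proof.
by move=> x0; apply/differentiable_continuous/derivable1_diffP/derivable_powR; rewrite in_itv/= x0.
Qed.

(** Monotone convergence along [[1 / (n + 2), 1]], with the fundamental theorem of calculus on each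
    interval. The offset 2 keeps the left end strictly below 1. *)
Lemma integral_powR_01 (a : R) : -1 < a ->
  (\int[mu]_(x in `]0%R, 1%R]) (x `^ a)%:E <= ((a + 1)^-1)%:E)%E.
Proof.
move=> a1; have a0 : 0 < a + 1 by lra.
pose F (n : nat) : set R := `[n.+2%:R^-1, 1%R]%classic.
have FE : `]0%R, 1%R]%classic = \bigcup_n F n.
  apply/seteqP; split => x /=.
    rewrite in_itv/= => /andP[x0 x1].
    have xi : 0 <= x^-1 by rewrite invr_ge0 ltW.
    exists (Num.bound x^-1) => //; rewrite /F/= in_itv/= x1 andbT.
    rewrite invf_ple ?posrE// ltW// (lt_le_trans (archi_boundP xi))// ler_nat.
    by apply: leqW; exact: leqnSn.
  move=> [n _]; rewrite /F/= !in_itv/= => /andP[xn ->]; rewrite andbT.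
  by rewrite (lt_le_trans _ xn)// invr_gt0.
have mF n : measurable (F n) by exact: measurable_itv.
have mp n : measurable_fun (F n) (fun x : R => (x `^ a)%:E).
  by apply/measurable_EFinP/measurable_funTS; exact: measurable_powR.
have ndF : nondecreasing_seq F.
  apply/nondecreasing_seqP => n; rewrite subsetEset => x; rewrite /F/= !in_itv/= => /andP[xn ->].
  by rewrite andbT (le_trans _ xn)// lef_pV2 ?posrE// ler_nat.
have pos n x : F n x -> (0 <= (x `^ a)%:E)%E by rewrite lee_fin powR_ge0.
have cv := ge0_nondecreasing_set_cvg_integral (mu := mu) ndF mF mp pos.
rewrite FE -(cvg_lim _ cv)//; apply: lime_le; first by apply/cvg_ex; eexists; exact: cv.
near=> n.
set b : R := n.+2%:R^-1.
have b0 : 0 < b by rewrite invr_gt0.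
have b1 : b < 1 by rewrite invf_lt1// ltr1n.
pose G (x : R) := (a + 1)^-1 * x `^ (a + 1).
have dG (x : R) : 0 < x -> is_derive x 1 G (x `^ a).
  move=> x0; have := is_derive1_powR (a + 1) x0 => d.
  have := @is_deriveZ _ _ _ (@powR R ^~ (a + 1)) (a + 1)^-1 x 1 _ d.
  by rewrite addrK /GRing.scale/= mulKf// gt_eqF.
have cG (x : R) : 0 < x -> {for x, continuous G}.
  by move=> x0; apply/differentiable_continuous/derivable1_diffP; have [] := dG x x0.
rewrite (@continuous_FTC2 _ (fun x => x `^ a) G b 1 b1).
- rewrite -EFinB lee_fin /G powR1 mulr1 gerBl mulr_ge0//; last exact: powR_ge0.
  by rewrite invr_ge0 ltW.
- apply: continuous_in_subspaceT => x; rewrite inE/= in_itv/= => /andP[bx _].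
  by apply: powR_continuous_gt0; lra.
- split.
  + by move=> x; rewrite in_itv/= => /andP[bx _]; have [] := dG x (lt_trans b0 bx).
  + by apply: cvg_at_right_filter; exact: cG.
  + by apply: cvg_at_left_filter; exact: cG.
- move=> x; rewrite in_itv/= => /andP[bx _]; rewrite derive1E.
  by have [_ ->] := dG x (lt_trans b0 bx).
Unshelve. all: by end_near. Qed.

Lemma half_line_integral_lty (a A B : R) (m : R -> R) : -1 < a -> 0 <= A -> 0 <= B ->
  measurable_fun setT m -> (forall x, 0 <= m x) ->
  (forall x, 0 < x <= 1 -> m x <= A * x `^ a) ->
  (forall x, 1 < x -> m x <= B * (oneDsqr x)^-1) ->
  (\int[mu]_(x in `[0%R, +oo[) (m x)%:E < +oo)%E.
Proof.
move=> a1 A0 B0 mm m0 mA mB.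
have mmE (D : set R) : measurable_fun D (fun x => (m x)%:E).
  exact/measurable_EFinP/measurable_funTS.
rewrite -integral_itv_obnd_cbnd//.
have -> : `]0%R, +oo[%classic = `]0%R, 1%R] `|` `]1%R, +oo[ :> set R.
  apply/seteqP; split => x /=; rewrite !in_itv/= ?andbT; last by case; lra.
  by have [x1|x1] := leP x 1 => x0; [left|right]; lra.
rewrite ge0_integral_setU//=; last 3 first.
- exact: mmE.
- by move=> x _; rewrite lee_fin.
- rewrite disj_set2E; apply/eqP; rewrite -subset0 => x []/=; rewrite !in_itv/=; lra.
rewrite lte_add_pinfty//.
- apply: (@le_lt_trans _ _ (\int[mu]_(x in `]0%R, 1%R]) (A%:E * (x `^ a)%:E))%E).
    apply: ge0_le_integral => //.
    + by move=> x _; rewrite lee_fin.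
    + exact: mmE.
    + apply: emeasurable_funM => //.
      by apply/measurable_EFinP/measurable_funTS; exact: measurable_powR.
  rewrite ge0_integralZl_EFin//; last 2 first.
  + by move=> x _; rewrite lee_fin powR_ge0.
  + by apply/measurable_EFinP/measurable_funTS; exact: measurable_powR.
  apply: (@le_lt_trans _ _ (A%:E * ((a + 1)^-1)%:E)%E); last by rewrite -EFinM ltry.
  by rewrite lee_wpmul2l// integral_powR_01.
- have mD (D : set R) : measurable_fun D (fun x : R => ((oneDsqr x)^-1)%:E).
    apply/measurable_EFinP/measurable_funTS; apply: continuous_measurable_fun.
    exact: continuous_oneDsqrV.
  have D0 x : (0 <= ((oneDsqr x)^-1 : R)%:E)%E.
    by rewrite lee_fin invr_ge0 (le_trans _ (oneDsqr_ge1 x)).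
  apply: (@le_lt_trans _ _ (\int[mu]_(x in `[0%R, +oo[) (B%:E * ((oneDsqr x)^-1)%:E))%E).
    apply: (@le_trans _ _ (\int[mu]_(x in `]1%R, +oo[) (B%:E * ((oneDsqr x)^-1)%:E))%E).
      apply: ge0_le_integral => //.
      + by move=> x _; rewrite lee_fin.
      + exact: mmE.
      + by apply: emeasurable_funM => //; exact: mD.
      + by move=> x /=; rewrite in_itv/= andbT => x1; rewrite -EFinM lee_fin mB.
    apply: ge0_subset_integral => //.
    + by apply: emeasurable_funM => //; exact: mD.
    + by move=> x _; rewrite mule_ge0.
    + by move=> x /=; rewrite !in_itv/= !andbT => /ltW; apply: le_trans.
  rewrite ge0_integralZl_EFin//; last exact: mD.
  by rewrite integral0y_oneDsqr -EFinM ltry.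
Qed.

Lemma line_integral_lty (a A B : R) (m : R -> R) : -1 < a -> 0 <= A -> 0 <= B ->
  measurable_fun setT m -> (forall x, 0 <= m x) ->
  (forall x, 0 < `|x| <= 1 -> m x <= A * `|x| `^ a) ->
  (forall x, 1 < `|x| -> m x <= B * (oneDsqr x)^-1) ->
  (\int[mu]_x (m x)%:E < +oo)%E.
Proof.
move=> a1 A0 B0 mm m0 mA mB.
have mN : measurable_fun setT (fun x : R => m (- x)).
  by apply: measurableT_comp => //; exact: oppr_measurable.
have -> : [set: R] = `]-oo, 0%R] `|` `]0%R, +oo[.
  apply/seteqP; split => x //= _; rewrite !in_itv/= andbT.
  by have [x0|x0] := leP x 0; [left|right].
rewrite ge0_integral_setU//=; last 3 first.
- exact/measurable_EFinP/measurable_funTS.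
- by move=> x _; rewrite lee_fin.
- rewrite disj_set2E; apply/eqP; rewrite -subset0 => x []/=; rewrite !in_itv/= andbT; lra.
rewrite lte_add_pinfty//.
- have -> : (\int[mu]_(x in `]-oo, 0%R]) (m x)%:E =
             \int[mu]_(x in `[0%R, +oo[) (m (- x))%:E)%E.
    rewrite (@ge0_integration_by_substitution0 _ (fun x => (m (- x))%:E)).
    + by apply: eq_integral => x _; rewrite opprK.
    + exact/measurable_EFinP.
    + by move=> x; rewrite lee_fin.
  apply: (half_line_integral_lty a1 A0 B0 mN) => // x hx.
  + by have := mA (- x); rewrite normrN gtr0_norm; [apply|lra].
  + have := mB (- x); rewrite normrN gtr0_norm; last by lra.
    by rewrite /oneDsqr sqrrN; apply.
- rewrite integral_itv_obnd_cbnd; last exact/measurable_EFinP/measurable_funTS.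
  apply: (half_line_integral_lty a1 A0 B0 mm) => // x hx.
  + by have := mA x; rewrite gtr0_norm; [apply|lra].
  + by have := mB x; rewrite gtr0_norm; [apply|lra].
Qed.

End Finiteness.

(** * The mollified potential *)

Section ScaledMollifier.
Context {R : realType}.
Notation mu := (@lebesgue_measure R).

Lemma std_mollifier_continuous (rho : R -> R) : std_mollifier rho -> continuous rho.
Proof.
case=> + _ _ _ _ => sm x; apply/differentiable_continuous/derivable1_diffP.
exact: sm 0%N x.
Qed.

Lemma std_mollifier_eq0 (rho : R -> R) x : std_mollifier rho -> 1 <= `|x| -> rho x = 0.
Proof.
case=> _ _ _ _ supp x1; apply/eqP/negPn/negP => rx.
have /supp : closure [set x | rho x != 0] x by apply: subset_closure.
rewrite /= in_itv/= => /andP[h1 h2].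
by move: x1; rewrite leNgt ltr_norml h1 h2.
Qed.

(** The bound comes from the maximum of [rho] on [[-1, 1]], outside of which [rho] vanishes; the
    mass from the substitution [x / eps]. *)
Lemma rho_eps_kernel (rho : R -> R) (eps : R) : std_mollifier rho -> 0 < eps ->
  exists M, is_kernel eps M (rho_eps rho eps).
Proof.
move=> sm e0; have crho := std_mollifier_continuous sm.
have [_ rho0 _ mass _] := sm.
have [c _ cmax] : exists2 c : R, c \in `[(-1 : R), 1] &
    forall t, t \in `[(-1 : R), 1] -> rho t <= rho c.
  by apply: EVT_max; [lra|exact: continuous_subspaceT].
have rhoc t : rho t <= rho c.
  have [t1|t1] := ltP `|t| 1; last by rewrite (std_mollifier_eq0 sm t1).
  by apply: cmax; rewrite in_itv/=; move: t1; rewrite ltr_norml => /andP[]; lra.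
have crho_eps : continuous (rho_eps rho eps).
  have cd : continuous (fun x : R => x / eps).
    by move=> x; apply: cvgM; [exact: cvg_id|exact: cvg_cst].
  have crd : continuous (rho \o (fun x : R => x / eps)).
    by move=> x; apply: continuous_comp; [exact: cd|exact: crho].
  by move=> x; apply: cvgM; [exact: cvg_cst|exact: crd].
exists (eps^-1 * rho c); split.
- by move=> x; rewrite mulr_ge0// invr_ge0 ltW.
- by move=> x; rewrite ler_wpM2l// invr_ge0 ltW.
- move=> x ex; rewrite /rho_eps (std_mollifier_eq0 sm) ?mulr0//.
  by rewrite normrM normfV [`|eps|]gtr0_norm// ler_pdivlMr// mul1r.
- exact: continuous_measurable_fun.
- rewrite -mass; apply/esym.
  pose F (x : R) := eps^-1 * x.
  have dF (x : R) : is_derive x 1 F (eps^-1).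
    have := @is_deriveZ _ _ _ (@id R) eps^-1 x 1 1 (is_derive_id x 1).
    by rewrite /GRing.scale/= mulr1.
  have F'E : F^`()%classic = cst eps^-1.
    by apply/funext => x; rewrite derive1E; have [_ ->] := dF x.
  have ei : 0 < eps^-1 by rewrite invr_gt0.
  rewrite (@increasing_ge0_integration_by_substitutionT _ F rho)//.
  + by apply: eq_integral => x _; rewrite F'E /rho_eps !fctE mulrC /F [x / eps]mulrC.
  + by move=> x y xy; rewrite /F ltr_pM2l.
  + by rewrite F'E => x; exact: cvg_cst.
  + by rewrite F'E; exact: is_cvg_cst.
  + by rewrite F'E; exact: is_cvg_cst.
  + by apply: gt0_cvgMrNy => //; exact: cvg_id.
  + by apply: gt0_cvgMry => //; exact: cvg_id.
Qed.

(** Convolution acts term by term on [uX]. The constant [kernel_mean r id] cancels in all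
    differences of [ueps]. *)
Lemma ueps_mollified_floor (rho : R -> R) (eps M : R) (T : nat) (xb : 'I_T -> R) x :
  is_kernel eps M (rho_eps rho eps) -> (0 < T)%N ->
  ueps rho eps xb x = x - kernel_mean (rho_eps rho eps) id -
    \sum_(i < T) mollified_floor T (rho_eps rho eps) (x - xb i).
Proof.
move=> kr T0; set r := rho_eps rho eps.
pose fl i y : R := (Num.floor ((x - xb i - y) / T%:R))%:~R.
have bfl i : bounded_on_ball eps (fl i) by exact: floor_shift_bounded_on_ball.
have bid := bounded_on_ball_id eps.
have bc := bounded_on_ball_cst eps x.
have bs : bounded_on_ball eps (fun y => \sum_(i < T) fl i y).
  exact: bounded_on_ball_sum.
have -> : \sum_(i < T) mollified_floor T r (x - xb i) =
          kernel_mean r (fun y => \sum_(i < T) fl i y).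
  by rewrite (kernel_mean_sum kr).
have bci := bounded_on_ballD bc (bounded_on_ballN bid).
have := kernel_meanD kr bci (bounded_on_ballN bs).
rewrite (kernel_meanD kr bc (bounded_on_ballN bid)) (kernel_mean_cst kr).
rewrite (kernel_meanN kr bid) (kernel_meanN kr bs) => <-.
apply: eq_Rintegral => y _; rewrite /uX /=; congr ((_ - _) * _).
by apply: eq_bigr => i _; rewrite /fl addrAC.
Qed.

End ScaledMollifier.

(** * Finiteness of the weighted energy *)

Section EnergyFiniteness.
Context {R : realType}.
Notation mu := (@lebesgue_measure R).
Context (T : nat) (w : R) (S : R -> R) (X : int -> R) (s p : R).
Context (T0 : (0 < T)%N) (stS : staircase T w S) (p1 : 1 < p)
  (s0 : 0 < s) (s1 : s < 1) (sp1 : 1 <= s * p).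

Let TR0 : 0 < @GRing.natmul R 1 T. Proof. by rewrite ltr0n. Qed.

Lemma staircase_int_period z (m : int) : S (z + m%:~R * T%:R) = S z + m%:~R.
Proof.
have step u : S (u + T%:R) = S u + 1 by exact: (staircase_period stS).
elim/int_ind: m => [|n IHn|n IHn].
- by rewrite mul0r !addr0.
- by rewrite -addn1 PoszD intrD mulrDl mul1r addrA step IHn addrA.
- have := step (z + (- n.+1%:Z)%:~R * T%:R).
  rewrite -addrA -[X in _ + (_ + X)]mul1r -mulrDl -[1 in X in X * _]/(1%:~R) -intrD.
  rewrite (_ : - n.+1%:Z + 1 = - n%:Z); last by lia.
  rewrite IHn => /eqP; rewrite -subr_eq => /eqP <-.
  by rewrite -addrA -[1]/(1%:~R) -intrB; congr (_ + _%:~R); lia.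
Qed.

(** With [m] the floor of [h / T], monotonicity and periodicity place both [h / T] and the increment
    of [S] in [[m, m + 1]]. *)
Lemma staircase_increment_approx x h : `|h / T%:R - (S (x + h) - S x)| <= 1.
Proof.
set m := Num.floor (h / T%:R).
have /andP[m1 m2] := @Num.Theory.floor_itv R (h / T%:R).
rewrite -/m intrD in m1 m2.
have tr0 := TR0.
have l1 : S (x + m%:~R * T%:R) <= S (x + h).
  by apply: (staircase_homo stS); rewrite lerD2l -ler_pdivlMr.
have l2 : S (x + h) <= S (x + m%:~R * T%:R + T%:R).
  have hm : h < (m%:~R + 1) * T%:R by rewrite -ltr_pdivrMr.
  rewrite mulrDl mul1r in hm; apply: (staircase_homo stS).
  by rewrite -addrA lerD2l ltW.
rewrite (staircase_period stS) !staircase_int_period in l1 l2.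
rewrite ler_norml; apply/andP; split; lra.
Qed.

(** The linear part is distributed as [h / T] to each of the [T] points, and every point then
    contributes at most 1. *)
Lemma increment_le_period h x : `|increment T S X h x| <= T%:R.
Proof.
have -> : increment T S X h x =
    \sum_(i < T) (h / T%:R - (S (x - X (i : nat) + h) - S (x - X (i : nat)))).
  rewrite sumrB sumr_const card_ord -[h / _ *+ _]mulr_natr divfK ?gt_eqF//.
  by congr (_ - _); apply: eq_bigr => i _; rewrite addrAC.
apply: (le_trans (ler_norm_sum _ _ _)).
rewrite -[leRHS]mulr1 -[in leRHS](card_ord T) mulr_natl -sumr_const.
by apply: ler_sum => i _; exact: staircase_increment_approx.
Qed.

Lemma increment_lipschitz : exists2 L, 0 <= L &
  forall h x, `|increment T S X h x| <= L * `|h|.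
Proof.
have [L L0 SL] := staircase_lipschitz stS.
exists (1 + T%:R * L); first by rewrite addr_ge0// mulr_ge0.
move=> h x; rewrite mulrDl mul1r (le_trans (ler_normB _ _))// lerD2l.
apply: (le_trans (ler_norm_sum _ _ _)).
rewrite -mulrA -[in leRHS](card_ord T) mulr_natl -sumr_const.
apply: ler_sum => i _; apply: (le_trans (SL _ _)).
by rewrite (_ : x + h - X i - (x - X i) = h)//; ring.
Qed.

Lemma increment_energy_ge0 h : 0 <= increment_energy T S p X h.
Proof. by apply: Rintegral_ge0 => x _; exact: powR_ge0. Qed.

Lemma increment_bounded_periodic h : bounded_periodic T%:R (increment T S X h).
Proof.
apply: bounded_periodicD; first exact: bounded_periodic_cst.
apply/bounded_periodicN/bounded_periodic_sum => i.
have := bounded_periodic_shift (- X (i : nat)) (staircase_increment_bounded_periodic stS h).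
by congr bounded_periodic; apply/funext => x; rewrite addrAC.
Qed.

Lemma increment_energy_le h C : 0 <= C -> (forall x, `|increment T S X h x| <= C) ->
  increment_energy T S p X h <= T%:R * C `^ p.
Proof.
move=> C0 hC; rewrite -(period_integral_cst TR0).
have p0 : 0 <= p by exact: le_trans (ltW p1).
apply: le_period_integral.
- by apply: (bounded_periodic_powR p0); exact: increment_bounded_periodic.
- exact: bounded_periodic_cst.
- by move=> x; rewrite ge0_ler_powR ?nnegrE.
Qed.

(** Near 0 the Lipschitz bound leaves [|h|^(p - 1 - sp)], integrable because [s < 1]. For [|h| > 1]
    the increments are bounded and [1 + sp >= 2], so the weight is at most [2 / (1 + h^2)]. *)
Lemma weighted_increment_energy_lty :
  measurable_fun setT (fun h : R => (`|h| `^ (1 + s * p))^-1 * increment_energy T S p X h) ->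
  (\int[mu]_h ((`|h| `^ (1 + s * p))^-1 * increment_energy T S p X h)%:E < +oo)%E.
Proof.
move=> mm; have [L L0 hL] := increment_lipschitz.
have p1' := p1; have sp1' := sp1.
have a1 : -1 < p - (1 + s * p).
  by have : 0 < p * (1 - s); [apply: mulr_gt0|]; have := s1; lra.
have t0 : 0 <= @GRing.natmul R 1 T by rewrite ler0n.
apply: (@line_integral_lty R (p - (1 + s * p)) (T%:R * L `^ p) (2 * (T%:R * T%:R `^ p))) => //.
- by rewrite !mulr_ge0 ?powR_ge0.
- by move=> h; rewrite mulr_ge0 ?increment_energy_ge0// invr_ge0 powR_ge0.
- move=> h /andP[h0 h1].
  have := increment_energy_le (mulr_ge0 L0 (normr_ge0 h)) (hL h).
  rewrite powRM// mulrA => le1.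
  rewrite powRB; last by rewrite (@gt_eqF _ _ `|h|)//; apply: implybT.
  by rewrite mulrA [leRHS]mulrC ler_wpM2l// invr_ge0 powR_ge0.
- move=> h h1.
  have le1 := increment_energy_le t0 (increment_le_period h).
  have hp : 0 < `|h| `^ (1 + s * p) by rewrite powR_gt0//; lra.
  have o1 := oneDsqr_ge1 h.
  have hq : (`|h| `^ (1 + s * p))^-1 <= 2 * (oneDsqr h)^-1.
    rewrite -[2]invrK -invfM lef_pV2 ?posrE//.
    have h2 : `|h| `^ 2%:R <= `|h| `^ (1 + s * p) by apply: ler_powR; lra.
    apply: le_trans h2; rewrite powR_mulrn// real_normK ?num_real// /oneDsqr.
    have : 1 <= `|h| ^+ 2 by rewrite exprn_ege1// ltW.
    rewrite real_normK ?num_real//; lra.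
  have i0 : 0 <= (`|h| `^ (1 + s * p))^-1 by rewrite invr_ge0 ltW.
  by rewrite (le_trans (ler_pM i0 (increment_energy_ge0 h) hq le1))// mulrAC.
Qed.

End EnergyFiniteness.

(** * Periodic extension of a configuration *)

Section PeriodicExtension.
Context {R : realType}.

(** Euclidean division [n = q T + r] sends [n] to [x_r + q T]. The period is written [T.+1] so that
    [inord] has an inhabited target. *)
Definition periodic_extension (T : nat) (xb : 'I_T.+1 -> R) (n : int) : R :=
  xb (inord `|(n %% T.+1)%Z|%N) + (n %/ T.+1)%Z%:~R * T.+1%:R.

Lemma periodic_extension_ord (T : nat) (xb : 'I_T.+1 -> R) (i : 'I_T.+1) :
  periodic_extension xb (i : nat) = xb i.
Proof.
have iT : (0 <= (i : nat)%:Z < `|T.+1%:Z|) by rewrite /= ltz_nat ltn_ord.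
rewrite /periodic_extension modz_small// divz_small// mul0r addr0.
by rewrite absz_nat inord_val.
Qed.

(** For [n < m] the pairs of quotient and remainder are ordered lexicographically, hence so are the
    points; being distinct index pairs, they are [dmin] apart. *)
Lemma separated_periodic_extension (T : nat) (w l : R) (xb : 'I_T.+1 -> R) :
  0 < l -> w <= l -> Xclass l xb -> separated_sequence T.+1 w (periodic_extension xb).
Proof.
move=> l0 wl [[xb01 xbs] dl]; split=> [n|n m nm].
  rewrite /periodic_extension modzDr divzDr ?dvdzz// divzz/= intrD mulrDl mul1r addrA.
  by [].
set i : 'I_T.+1 := inord `|(n %% T.+1)%Z|%N.
set j : 'I_T.+1 := inord `|(m %% T.+1)%Z|%N.
have iE : (i : nat)%:Z = (n %% T.+1)%Z.
  have h0 : 0 <= (n %% T.+1)%Z by apply: modz_ge0.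
  have h1 : (n %% T.+1)%Z < T.+1 by apply: ltz_pmod.
  by rewrite /i inordK ?gez0_abs// -ltz_nat gez0_abs.
have jE : (j : nat)%:Z = (m %% T.+1)%Z.
  have h0 : 0 <= (m %% T.+1)%Z by apply: modz_ge0.
  have h1 : (m %% T.+1)%Z < T.+1 by apply: ltz_pmod.
  by rewrite /j inordK ?gez0_abs// -ltz_nat gez0_abs.
have nE := divz_eq n T.+1; have mE := divz_eq m T.+1.
rewrite -iE in nE; rewrite -jE in mE.
rewrite /periodic_extension -/i -/j.
set a := (n %/ T.+1)%Z in nE *; set b := (m %/ T.+1)%Z in mE *.
have ltiT := ltn_ord i; have ltjT := ltn_ord j.
have ab : a <= b by nia.
have le_ext : xb i + a%:~R * T.+1%:R <= xb j + b%:~R * T.+1%:R.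
  have [eab|nab] := eqVneq a b.
    by rewrite eab lerD2r; apply: xbs; rewrite -lez_nat; nia.
  have ab1 : a%:~R + 1 <= b%:~R :> R by rewrite -[1]/(1%:~R) -intrD ler_int; lia.
  have : (a%:~R + 1) * T.+1%:R <= b%:~R * T.+1%:R :> R by rewrite ler_wpM2r.
  have /andP[_ ?] := xb01 i; have /andP[? _] := xb01 j.
  rewrite mulrDl mul1r; lra.
have nij : (i, a) <> (j, b) by move=> [ij eab]; move: nm; rewrite nE mE ij eab ltxx.
have : l <= `|(xb i + a%:~R * T.+1%:R) - (xb j + b%:~R * T.+1%:R)|.
  apply: (le_trans dl); apply: ge_inf.
    by exists 0 => _ [? [? [? [? [_ ->]]]]].
  by exists i, j, a, b.
rewrite distrC ger0_norm ?subr_ge0//; lra.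
Qed.

Lemma Xclass_Xeq (l : R) (T : nat) : l <= 1 -> Xclass l (@Xeq R T.+1).
Proof.
move=> l1; split.
  split=> [i|i j ij]; last by rewrite /Xeq ler_nat.
  by rewrite /Xeq ler0n ltr_nat ltn_ord.
apply: lb_le_inf.
  (* The infimum needs a nonempty set: the point 0 and its translate by one period. *)
  exists `|(@Xeq R T.+1 ord0 + 0%:~R * T.+1%:R) - (@Xeq R T.+1 ord0 + 1%:~R * T.+1%:R)|.
  by exists ord0, ord0, 0, 1.
move=> _ [i [j [k [m [nij ->]]]]].
have -> : @Xeq R T.+1 i + k%:~R * T.+1%:R - (@Xeq R T.+1 j + m%:~R * T.+1%:R) =
    ((i : nat)%:Z + k * T.+1 - ((j : nat)%:Z + m * T.+1))%:~R :> R.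
  by rewrite intrB !intrD !intrM.
rewrite -intr_norm (le_trans l1)// -[1]/(1%:~R) ler_int.
have ltiT := ltn_ord i; have ltjT := ltn_ord j.
suff : (i : nat)%:Z + k * T.+1 - ((j : nat)%:Z + m * T.+1) != 0 by lia.
apply/eqP => e0; apply: nij.
have km : k = m by nia.
by congr pair => //; apply: val_inj; rewrite /=; move: e0; rewrite km; lia.
Qed.

Lemma cfg_set_unit_gaps (T : nat) (xb : 'I_T.+1 -> R) :
  (forall i : 'I_T.+1,
     periodic_extension xb (i : nat) - periodic_extension xb ((i : nat)%:Z - 1) = 1) ->
  cfg_set xb = [set x + xb ord0 | x in cfg_set (@Xeq R T.+1)].
Proof.
move=> gap1.
have xbE (i : 'I_T.+1) : xb i = (i : nat)%:R + xb ord0.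
  case: i => n; elim: n => [|n IHn] nT.
    by rewrite add0r; congr xb; apply: val_inj.
  have nT' : (n < T.+1)%N by apply: leq_trans nT.
  have := gap1 (Ordinal nT); rewrite periodic_extension_ord/=.
  rewrite (_ : n.+1%:Z - 1 = (Ordinal nT' : nat)%:Z); last by rewrite /=; lia.
  by rewrite periodic_extension_ord IHn/= -natr1; lra.
apply/seteqP; split => [_ [i [k ->]]|_ [_ [i [k ->]] <-]].
- by exists (@Xeq R T.+1 i + k%:~R * T.+1%:R); [exists i, k|rewrite [xb i]xbE /Xeq addrAC].
- by exists i, k; rewrite [xb i]xbE /Xeq addrAC.
Qed.

End PeriodicExtension.

(** * Strict comparison of integrals *)

Section StrictIntegral.
Context {R : realType}.
Notation mu := (@lebesgue_measure R).

(** Write [g = f + (g - f)]: the second integral is positive, and finiteness of the first turns this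
    into a strict inequality. *)
Lemma lt_integral_itv (f g : R -> R) (a b : R) :
  measurable_fun setT f -> measurable_fun setT g -> (forall x, 0 <= f x) ->
  (forall x, f x <= g x) -> a < b -> (forall x, a < x < b -> f x < g x) ->
  (\int[mu]_x (f x)%:E < +oo)%E -> (\int[mu]_x (f x)%:E < \int[mu]_x (g x)%:E)%E.
Proof.
move=> mf mg f0 fg ab fgab ifoo.
have -> : (\int[mu]_x (g x)%:E =
           \int[mu]_x (f x)%:E + \int[mu]_x (g x - f x)%:E)%E.
  rewrite -ge0_integralD//.
  - by apply: eq_integral => x _; rewrite -EFinD subrKC.
  - by move=> x _; rewrite lee_fin.
  - exact/measurable_EFinP.
  - by move=> x _; rewrite lee_fin subr_ge0.
  - by apply/measurable_EFinP; exact: measurable_funB.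
rewrite lteDl; last by rewrite ge0_fin_numE// integral_ge0// => x _; rewrite lee_fin.
apply: (@integral_gt0 _ _ `]a, b[%classic) => //.
- by rewrite lebesgue_measure_itv/= lte_fin ab -EFinB lte_fin subr_gt0.
- by apply/measurable_EFinP; exact: measurable_funB.
- by move=> x _; rewrite lee_fin subr_ge0.
- by move=> x /=; rewrite in_itv/= => xab; rewrite lte_fin subr_gt0 fgab.
Qed.

End StrictIntegral.

Lemma increment_ord (R : realType) (T : nat) (S : R -> R) (h x : R)
    (X : int -> R) (xb : 'I_T -> R) : (forall i : 'I_T, X (i : nat) = xb i) ->
  increment T S X h x = h - (\sum_(i < T) S (x + h - xb i) - \sum_(i < T) S (x - xb i)).
Proof.
by move=> XE; rewrite /increment -sumrB; congr (h - _); apply: eq_bigr => i _; rewrite XE.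
Qed.

Lemma sub_affine (R : comRingType) (x h c a b : R) :
  x + h - c - a - (x - c - b) = h - (a - b).
Proof.
ring.
Qed.

(** * The functional as a weighted integral of increment energies *)

Section EnergyRepresentation.
Context {R : realType}.
Notation mu := (@lebesgue_measure R).
Context (rho : R -> R) (eps M p s : R) (T : nat).
Context (kr : is_kernel eps M (rho_eps rho eps)) (e0 : 0 < eps) (e4 : eps <= 4^-1)
  (p0 : 0 <= p) (T0 : (0 < T)%N).
Let S := mollified_floor T (rho_eps rho eps).

Let stS : staircase T (2 * eps) S. Proof. exact: staircase_mollified_floor kr _ _ _. Qed.

Lemma ueps_increment (xb : 'I_T -> R) (X : int -> R) h x :
  (forall i : 'I_T, X (i : nat) = xb i) ->
  ueps rho eps xb (x + h) - ueps rho eps xb x = increment T S X h x.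
Proof.
move=> XE; rewrite (increment_ord S h x XE) !(ueps_mollified_floor _ _ kr)//.
exact: sub_affine.
Qed.

Let bp_ueps (xb : 'I_T -> R) (X : int -> R) : (forall i : 'I_T, X (i : nat) = xb i) ->
  forall h, bounded_periodic T%:R (fun x => ueps rho eps xb (x + h) - ueps rho eps xb x).
Proof.
move=> XE h; under eq_fun do rewrite (ueps_increment _ _ XE).
exact: increment_bounded_periodic stS _.
Qed.

Let m_ueps (xb : 'I_T -> R) : measurable_fun setT (ueps rho eps xb).
Proof.
have mS : measurable_fun setT S.
  by apply: nondecreasing_measurable => // x y xy; exact: (staircase_homo stS).
have -> : ueps rho eps xb = fun x => x - kernel_mean (rho_eps rho eps) id -
    \sum_(i < T) S (x - xb i).
  by apply/funext => x; exact: ueps_mollified_floor kr T0.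
apply: measurable_funB; first exact: measurable_funB.
apply: measurable_sum => i; apply: (measurableT_comp mS).
exact: measurable_funB.
Qed.

Let energyE (xb : 'I_T -> R) (X : int -> R) : (forall i : 'I_T, X (i : nat) = xb i) ->
  difference_energy T%:R p (ueps rho eps xb) = increment_energy T S p X.
Proof.
move=> XE; apply/funext => h; congr period_integral; apply/funext => x.
by rewrite (ueps_increment _ _ XE).
Qed.

Let TR0 : 0 < @GRing.natmul R 1 T. Proof. by rewrite ltr0n. Qed.

Lemma measurable_weighted_energy (xb : 'I_T -> R) (X : int -> R) :
  (forall i : 'I_T, X (i : nat) = xb i) ->
  measurable_fun setT (fun h : R => (`|h| `^ (1 + s * p))^-1 * increment_energy T S p X h).
Proof.
move=> XE; have := measurable_difference_energy (1 + s * p) p0 (m_ueps xb) (bp_ueps XE).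
by rewrite (energyE XE) => /measurable_EFinP.
Qed.

Lemma Fsep_increment_energy (xb : 'I_T -> R) (X : int -> R) :
  (forall i : 'I_T, X (i : nat) = xb i) ->
  Fsep rho s p eps xb =
  (\int[mu]_h ((`|h| `^ (1 + s * p))^-1 * increment_energy T S p X h)%:E)%E.
Proof.
move=> XE; have := integral_difference_quotient (1 + s * p) p0 (m_ueps xb) (bp_ueps XE).
by rewrite (energyE XE).
Qed.

End EnergyRepresentation.

(** * Minimality of the lattice and uniqueness up to translation *)

Theorem mainTheorem10 (R : realType) (rho : R -> R) (eps p s : R) (T : nat) :
  std_mollifier rho ->
  0 < eps -> eps <= 4^-1 ->
  1 <= p ->
  0 < s -> s < 1 -> 1 <= s * p ->
  (0 < T)%N ->
  [/\ Xclass (4 * eps) (@Xeq R T),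
      (forall xb : 'I_T -> R, Xclass (4 * eps) xb ->
         (Fsep rho s p eps (@Xeq R T) <= Fsep rho s p eps xb)%E) &
      (forall xb : 'I_T -> R, Xclass (4 * eps) xb ->
         (forall yb : 'I_T -> R, Xclass (4 * eps) yb ->
            (Fsep rho s p eps xb <= Fsep rho s p eps yb)%E) ->
         exists a : R, cfg_set xb = [set x + a | x in cfg_set (@Xeq R T)])].
Proof.
move=> sm e0 e4 _ s0 s1 sp1.
case: T => [//|T] T0.
have p1 : 1 < p.
  have p_gt0 : 0 < p by rewrite -(pmulr_rgt0 _ s0); lra.
  by apply: le_lt_trans sp1 _; rewrite gtr_pMl.
have p0 : 0 <= p by lra.
have [M kr] := rho_eps_kernel sm e0.
have stS := staircase_mollified_floor kr e0 e4 T0.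
set S := mollified_floor T.+1 (rho_eps rho eps) in stS.
have eqX : Xclass (4 * eps) (@Xeq R T.+1) by apply: Xclass_Xeq; lra.
have XeqE (i : 'I_T.+1) : (intr : int -> R) (i : nat) = @Xeq R T.+1 i by [].
have Feq := Fsep_increment_energy s kr e0 e4 p0 T0 XeqE.
have meq := measurable_weighted_energy s kr e0 e4 p0 T0 XeqE.
have w2 : 2 * eps <= 2^-1 by lra.
have wge0 (h : R) : 0 <= (`|h| `^ (1 + s * p))^-1 :> R by rewrite invr_ge0 powR_ge0.
have Eeq_ge0 (h : R) :
    0 <= (`|h| `^ (1 + s * p))^-1 * increment_energy T.+1 S p (intr : int -> R) h.
  by rewrite mulr_ge0 ?wge0 ?increment_energy_ge0.
split; first exact: eqX.
  move=> xb Xxb.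
  have sep : separated_sequence T.+1 (2 * eps) (periodic_extension xb).
    by apply: separated_periodic_extension Xxb; lra.
  have FX := Fsep_increment_energy s kr e0 e4 p0 T0 (periodic_extension_ord xb).
  have mX := measurable_weighted_energy s kr e0 e4 p0 T0 (periodic_extension_ord xb).
  rewrite Feq FX; apply: ge0_le_integral.
  - exact: measurableT.
  - by move=> h _; rewrite lee_fin; exact: Eeq_ge0.
  - by move/measurable_EFinP: meq.
  - by move/measurable_EFinP: mX.
  - move=> h _; rewrite lee_fin.
    exact: ler_wpM2l (wge0 h) _ _ (lattice_energy_le T0 stS p1 h w2 sep).
move=> xb Xxb xbmin.
have sep : separated_sequence T.+1 (2 * eps) (periodic_extension xb).
  by apply: separated_periodic_extension Xxb; lra.
have FX := Fsep_increment_energy s kr e0 e4 p0 T0 (periodic_extension_ord xb).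
have mX := measurable_weighted_energy s kr e0 e4 p0 T0 (periodic_extension_ord xb).
exists (xb ord0); apply: cfg_set_unit_gaps => i.
(* A non-unit gap would make the lattice strictly better on an interval of shifts, contradicting
   minimality of [xb]. *)
apply/eqP/negPn/negP => gi.
have [dl dl0 Hdl] := lattice_energy_lt T0 stS p1 w2 sep (ex_intro _ i gi).
have := xbmin _ eqX; rewrite leNgt => /negP; apply; rewrite Feq FX.
(* The bound 1 keeps []1 - d, 1 + d[] inside the positive shifts, where the weight is positive. *)
pose d := Num.min dl 1.
have d0 : 0 < d by rewrite lt_min dl0 ltr01.
have d1 : d <= 1 by rewrite ge_min lexx orbT.
have ddl : d <= dl by rewrite ge_min lexx.
apply: (lt_integral_itv meq mX _ _ (a := 1 - d) (b := 1 + d)).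
- exact: Eeq_ge0.
- move=> h; exact: ler_wpM2l (wge0 h) _ _ (lattice_energy_le T0 stS p1 h w2 sep).
- lra.
- move=> h /andP[h1 h2]; rewrite ltr_pM2l.
    by apply: Hdl; rewrite ltr_norml; apply/andP; split; lra.
  by rewrite invr_gt0; apply: powR_gt0; rewrite gtr0_norm; lra.
- exact: (weighted_increment_energy_lty T0 stS p1 s0 s1 sp1 meq).
Qed.
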